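(* Let $M\rightarrow M'$ be an oriented matroid perspective on a (finite) linearly ordered set $E$. Then, as an identity of polynomials in the indeterminates $x,u,y,v$, $$t(M,M';x+u,y+v,1)=\sum_{A\subseteq E} x^{\theta^*_{M'}(A)}\,u^{\overline{\theta}^*_{M'}(A)}\,y^{\theta_M(A)}\,v^{\overline{\theta}_M(A)},$$ where $t(M,M';x,y,z)$ denotes the 3-variable Tutte polynomial of $M\rightarrow M'$.
   Context: Two oriented matroids $M,M'$ on the same finite set $E$ form an oriented matroid perspective, denoted $M\rightarrow M'$, if every signed circuit of $M$ is a conformal union of signed circuits of $M'$ (equivalently, every signed cocircuit of $M'$ is a conformal union of signed cocircuits of $M$). Here signed sets $Y\subseteq X$ are conformal if $Y^+\subseteq X^+$ and $Y^-\subseteq X^-$; a signed circuit $X$ is a conformal union of signed circuits $Y_i$ if $X^+=\bigcup_i Y_i^+$ and $X^-=\bigcup_i Y_i^-$. The Tutte polynomial of the perspective is $$t(M,M';x,y,z)=\sum_{A\subseteq E}(x-1)^{r(M')-r_{M'}(A)}(y-1)^{|A|-r_M(A)}z^{r(M)-r(M')-(r_M(A)-r_{M'}(A))},$$ where $r_N(A)$ is the rank of $A$ in the underlying matroid of $N$ and $r(N)=r_N(E)$. For an oriented matroid $N$ on a finite linearly ordered set $E$: a positive circuit (resp. cocircuit) is a signed circuit (resp. cocircuit) $X=(X^+,X^-)$ with $X^-=\emptyset$; $O(N)$ is the set of elements of $E$ that are the smallest element of some positive circuit of $N$; $O^*(N)=O(N^* )$ is the set of elements of $E$ that are the smallest element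 of some positive cocircuit of $N$. For $A\subseteq E$, $-_AN$ is the oriented matroid obtained from $N$ by reorientation on $A$ (the signs of the elements of $A$ are reversed in all signed circuits and cocircuits). The four $\theta$-activities are $$\theta_N(A)=|O(-_AN)\setminus A|,\quad \overline{\theta}_N(A)=|O(-_AN)\cap A|,$$ $$\theta^*_N(A)=|O^*(-_AN)\setminus A|,\quad \overline{\theta}^*_N(A)=|O^*(-_AN)\cap A|.$$ *)

(* Defs.v *)
From HB Require Import structures.
From mathcomp Require Import all_boot all_order all_algebra.
From mathcomp Require Export mpoly.

Set Implicit Arguments.
Unset Strict Implicit.
Unset Printing Implicit Defensive.

Import GRing.Theory.

(* Signed subsets X = (X^+, X^-) of E. *)
Record sset (E : finType) := SSet {
  sset_val : {set E} * {set E};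
  _ : [disjoint sset_val.1 & sset_val.2]
}.

HB.instance Definition _ (E : finType) := [isSub for @sset_val E].
HB.instance Definition _ (E : finType) := [Finite of sset E by <:].

Definition pos (E : finType) (X : sset E) : {set E} := (val X).1.
Definition neg (E : finType) (X : sset E) : {set E} := (val X).2.
Definition supp (E : finType) (X : sset E) : {set E} := pos X :|: neg X.

Lemma pos_neg_disjoint (E : finType) (X : sset E) : [disjoint pos X & neg X].
Proof. exact: (valP X). Qed.

Lemma sset_eqP (E : finType) (X Y : sset E) :
  pos X = pos Y -> neg X = neg Y -> X = Y.
Proof.
rewrite /pos /neg => Hp Hn; apply: val_inj.
by move: Hp Hn; case: (val X) => a b; case: (val Y) => c d /= -> ->.
Qed.

Fact opp_disjoint (E : finType) (X : sset E) : [disjoint neg X & pos X].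
Proof. by rewrite disjoint_sym pos_neg_disjoint. Qed.

Definition opp (E : finType) (X : sset E) : sset E :=
  @SSet E (neg X, pos X) (opp_disjoint X).

Record orientedMatroid (E : finType) := OrientedMatroid {
  circuits : {set sset E};
  circuit_neq0 : forall X, X \in circuits -> supp X != set0;
  circuit_opp : forall X, X \in circuits -> opp X \in circuits;
  circuit_incomparable : forall X Y, X \in circuits -> Y \in circuits ->
    supp X \subset supp Y -> X = Y \/ X = opp Y;
  circuit_elimination : forall X Y (e : E),
    X \in circuits -> Y \in circuits -> X <> opp Y ->
    e \in pos X :&: neg Y ->
    exists2 Z, Z \in circuits &
      pos Z \subset (pos X :|: pos Y) :\ e /\
      neg Z \subset (neg X :|: neg Y) :\ e
}.

(** Underlying matroid *)

Definition independent (E : finType) (M : orientedMatroid E) (I : {set E}) :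
    bool :=
  [forall X in circuits M, ~~ (supp X \subset I)].

Definition rk (E : finType) (M : orientedMatroid E) (A : {set E}) : nat :=
  \max_(I : {set E} | independent M I && (I \subset A)) #|I|.

Definition basis (E : finType) (M : orientedMatroid E) (B : {set E}) : bool :=
  maxset (independent M) B.

(* The bases of the dual matroid are the complements of bases, so its circuits
   are the minimal sets that meet every basis. *)
Definition matroid_cocircuit (E : finType) (M : orientedMatroid E)
    (D : {set E}) : bool :=
  minset (fun D' : {set E} => [forall B, basis M B ==> (D' :&: B != set0)]) D.

(** Signed cocircuits *)

(* There is a common element of equal signs iff there is one of opposite
   signs. *)
Definition orthogonal (E : finType) (X Y : sset E) : bool :=
  ((pos X :&: pos Y) :|: (neg X :&: neg Y) == set0) ==
  ((pos X :&: neg Y) :|: (neg X :&: pos Y) == set0).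

(* The signed circuits of the dual N^*: the signature of the cocircuits of the
   underlying matroid that is orthogonal to the signed circuits of N. *)
Definition cocircuits (E : finType) (N : orientedMatroid E) : {set sset E} :=
  [set D | matroid_cocircuit N (supp D) &
           [forall X in circuits N, orthogonal X D]].

(** Reorientation *)

Section Reorientation.

Context (E : finType) (A : {set E}).

Definition reorient_val (X : sset E) : {set E} * {set E} :=
  ((pos X :\: A) :|: (neg X :&: A), (neg X :\: A) :|: (pos X :&: A)).

Fact reorient_disjoint (X : sset E) :
  [disjoint (reorient_val X).1 & (reorient_val X).2].
Proof.
apply/pred0P => e /=; rewrite !inE.
have := pred0P (pos_neg_disjoint X) e; rewrite /=.
by case: (e \in A); case: (e \in pos X); case: (e \in neg X).
Qed.

Definition reorient_sset (X : sset E) : sset E :=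
  @SSet E (reorient_val X) (reorient_disjoint X).

Lemma in_pos_reorient X e : (e \in pos (reorient_sset X)) =
  if e \in A then e \in neg X else e \in pos X.
Proof. by rewrite !inE; case: (e \in A); rewrite /= ?andbT ?andbF ?orbF. Qed.

Lemma in_neg_reorient X e : (e \in neg (reorient_sset X)) =
  if e \in A then e \in pos X else e \in neg X.
Proof. by rewrite !inE; case: (e \in A); rewrite /= ?andbT ?andbF ?orbF. Qed.

Lemma reorient_ssetK : involutive reorient_sset.
Proof.
move=> X; apply: sset_eqP; apply/setP => e.
  by rewrite in_pos_reorient in_neg_reorient in_pos_reorient; case: (e \in A).
by rewrite in_neg_reorient in_pos_reorient in_neg_reorient; case: (e \in A).
Qed.

Lemma supp_reorient X : supp (reorient_sset X) = supp X.
Proof.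
apply/setP => e; rewrite !inE.
by case: (e \in A); case: (e \in pos X); case: (e \in neg X).
Qed.

Lemma opp_reorient X : opp (reorient_sset X) = reorient_sset (opp X).
Proof. exact: sset_eqP. Qed.

Lemma in_reorient_circuits (C : {set sset E}) X :
  (X \in [set reorient_sset Y | Y in C]) = (reorient_sset X \in C).
Proof.
apply/imsetP/idP => [[Y YC ->]|XC]; first by rewrite reorient_ssetK.
by exists (reorient_sset X); rewrite ?reorient_ssetK.
Qed.

Context (N : orientedMatroid E).
Let C := [set reorient_sset X | X in circuits N].

Fact reorient_circuit_neq0 X : X \in C -> supp X != set0.
Proof.
by rewrite in_reorient_circuits => /circuit_neq0; rewrite supp_reorient.
Qed.

Fact reorient_circuit_opp X : X \in C -> opp X \in C.
Proof.
by rewrite !in_reorient_circuits => /circuit_opp; rewrite opp_reorient.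
Qed.

Fact reorient_circuit_incomparable X Y :
  X \in C -> Y \in C -> supp X \subset supp Y -> X = Y \/ X = opp Y.
Proof.
rewrite !in_reorient_circuits => XC YC sXY.
have := circuit_incomparable XC YC; rewrite !supp_reorient => /(_ sXY).
rewrite opp_reorient.
by case=> /(can_inj reorient_ssetK); [left | right].
Qed.

Fact reorient_circuit_elimination X Y (e : E) :
  X \in C -> Y \in C -> X <> opp Y -> e \in pos X :&: neg Y ->
  exists2 Z, Z \in C &
    pos Z \subset (pos X :|: pos Y) :\ e /\
    neg Z \subset (neg X :|: neg Y) :\ e.
Proof.
rewrite !in_reorient_circuits => XC YC XY eXY.
have rXY : reorient_sset X <> opp (reorient_sset Y).
  by rewrite opp_reorient => /(can_inj reorient_ssetK).
have rYX : reorient_sset Y <> opp (reorient_sset X).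
  move=> YX; apply: rXY; rewrite YX; exact: sset_eqP.
have [Z ZC [Zp Zn]] : exists2 Z, Z \in circuits N &
    pos Z \subset (pos (reorient_sset X) :|: pos (reorient_sset Y)) :\ e /\
    neg Z \subset (neg (reorient_sset X) :|: neg (reorient_sset Y)) :\ e.
  move: eXY; rewrite in_setI => /andP[eX eY].
  case: (boolP (e \in A)) => eA.
    have [|Z ZC [Zp Zn]] := circuit_elimination (e := e) YC XC rYX.
      by rewrite in_setI in_pos_reorient in_neg_reorient eA eX eY.
    by exists Z => //; rewrite ![_ (reorient_sset X) :|: _]setUC.
  apply: circuit_elimination => //.
  by rewrite in_setI in_pos_reorient in_neg_reorient (negPf eA) eX eY.
exists (reorient_sset Z); first by rewrite in_reorient_circuits reorient_ssetK.
split; apply/subsetP => f; move: (subsetP Zp f) (subsetP Zn f);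
  rewrite ?(in_setD1, in_setU, in_pos_reorient, in_neg_reorient);
  by case: (f \in A).
Qed.

Definition reorient : orientedMatroid E :=
  OrientedMatroid reorient_circuit_neq0 reorient_circuit_opp
    reorient_circuit_incomparable reorient_circuit_elimination.

Lemma cocircuits_reorient :
  cocircuits reorient = [set reorient_sset D | D in cocircuits N].
Proof.
have indE I : independent reorient I = independent N I.
  apply/forall_inP/forall_inP => H X.
    by move=> XC; rewrite -supp_reorient H // imset_f.
  by rewrite in_reorient_circuits -(supp_reorient X); apply: H.
have cocE D : matroid_cocircuit reorient D = matroid_cocircuit N D.
  rewrite /matroid_cocircuit; apply: minset_eq => D'.
  apply: eq_forallb => B; congr (_ ==> _).
  exact: maxset_eq.
have orthE X D : orthogonal (reorient_sset X) (reorient_sset D) =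
                 orthogonal X D.
  rewrite /orthogonal.
  have agreeE : (pos (reorient_sset X) :&: pos (reorient_sset D)) :|:
      (neg (reorient_sset X) :&: neg (reorient_sset D)) =
      (pos X :&: pos D) :|: (neg X :&: neg D).
    apply/setP => e.
    rewrite !in_setU !in_setI !in_pos_reorient !in_neg_reorient.
    by case: (e \in A) => //; rewrite orbC.
  have oppositeE : (pos (reorient_sset X) :&: neg (reorient_sset D)) :|:
      (neg (reorient_sset X) :&: pos (reorient_sset D)) =
      (pos X :&: neg D) :|: (neg X :&: pos D).
    apply/setP => e.
    rewrite !in_setU !in_setI !in_pos_reorient !in_neg_reorient.
    by case: (e \in A) => //; rewrite orbC.
  by rewrite agreeE oppositeE.
apply/setP => D; rewrite in_reorient_circuits !in_set cocE supp_reorient.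
congr (_ && _); apply/forall_inP/forall_inP => H X.
  by move=> XC; rewrite -orthE reorient_ssetK H // imset_f.
by rewrite in_reorient_circuits => XC; rewrite -orthE H.
Qed.

End Reorientation.

(** Perspectives and their Tutte polynomial *)

Definition perspective (E : finType) (M M' : orientedMatroid E) : Prop :=
  forall X, X \in circuits M ->
    exists F : {set sset E},
      [/\ F \subset circuits M',
          pos X = \bigcup_(Y in F) pos Y &
          neg X = \bigcup_(Y in F) neg Y].

Local Open Scope ring_scope.

(* For a perspective, rk M A - rk M' A is nonnegative and nondecreasing in A,
   so that no subtraction in the exponents truncates. *)
Definition tutte (E : finType) (M M' : orientedMatroid E) : {mpoly int[3]} :=
  let x := 'X_(@Ordinal 3 0 isT) in
  let y := 'X_(@Ordinal 3 1 isT) in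
  let z := 'X_(@Ordinal 3 2 isT) in
  \sum_(A : {set E})
     (x - 1) ^+ (rk M' [set: E] - rk M' A) *
     (y - 1) ^+ (#|A| - rk M A) *
     z ^+ ((rk M [set: E] - rk M' [set: E]) - (rk M A - rk M' A)).

(** Activities *)

Definition smallest (d : Order.disp_t) (E : finOrderType d) (S : {set E})
    (e : E) : bool :=
  (e \in S) && [forall f in S, (e <= f)%O].

Definition positive (E : finType) (X : sset E) : bool := neg X == set0.

Definition Oact (d : Order.disp_t) (E : finOrderType d)
    (N : orientedMatroid E) : {set E} :=
  [set e | [exists X in circuits N, positive X && smallest (supp X) e]].

Definition Oact_dual (d : Order.disp_t) (E : finOrderType d)
    (N : orientedMatroid E) : {set E} :=
  [set e | [exists D in cocircuits N, positive D && smallest (supp D) e]].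

Definition theta (d : Order.disp_t) (E : finOrderType d)
    (N : orientedMatroid E) (A : {set E}) : nat :=
  #|Oact (reorient A N) :\: A|.

Definition theta_bar (d : Order.disp_t) (E : finOrderType d)
    (N : orientedMatroid E) (A : {set E}) : nat :=
  #|Oact (reorient A N) :&: A|.

Definition theta_dual (d : Order.disp_t) (E : finOrderType d)
    (N : orientedMatroid E) (A : {set E}) : nat :=
  #|Oact_dual (reorient A N) :\: A|.

Definition theta_bar_dual (d : Order.disp_t) (E : finOrderType d)
    (N : orientedMatroid E) (A : {set E}) : nat :=
  #|Oact_dual (reorient A N) :&: A|.

(* Main.v *)
Require Import Defs.
From mathcomp Require Import all_boot all_order all_algebra.
From mathcomp Require Import mpoly.
From mathcomp Require Import ring.
Import Defs.

Set Implicit Arguments.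
Unset Strict Implicit.
Unset Printing Implicit Defensive.

Import Order.TTheory GRing.Theory.

(** Setting z = 1 turns the left-hand side into the sum over A of
    (x + u - 1)^(corank of A in M') * (y + v - 1)^(nullity of A in M).  Both
    sides obey the same deletion/contraction recursion in the greatest element
    of E, and the proof runs that recursion without ever forming a minor.

    For T closed upwards in the order, [hybrid T] is a sum over A in which A
    says which elements of T are contracted (those in A) or deleted (the
    others), and which elements outside T are reoriented.  A positive circuit
    of the reoriented minor is then just a circuit of M obeying a sign pattern:
    one prescribed sign outside T, no sign at a deleted element, either sign at
    a contracted one.  With T empty, [hybrid T] is the right-hand side; with
    T = E, its factors single out the elements at which the rank of M' grows
    and those at which the rank of M fails to grow, hence give the left-hand
    side ([rk_count]).

    Moving the greatest element w outside T into T leaves the sum unchanged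
    ([hybrid_step]): in the sum over A and A + w, the two signs at w are traded
    for the patterns none and any.  Strong circuit elimination at w shows that
    one of the two signs yields the same activities as none, and the other one
    the same as any ([toggle]).  Since every circuit of M contains a circuit of
    M' with the same signs, through any given element, the choice can be made
    for M and M' at once.  If w is a loop of the minor of M or an isthmus of
    the minor of M', the four patterns agree away from w ([toggle_degenerate]),
    and the factors at w balance because y + v = 1 + (y + v - 1), and likewise
    for x + u.

    Cocircuits are reduced to circuits by the painting lemma ([painting]):
    an element is the least one of a suitable cocircuit of M' exactly when no
    circuit of M' with the complementary pattern blocks it.  The painting lemma
    rests on the existence of an orthogonal signature of every cocircuit of the
    underlying matroid ([cocircuit_signature]), which is built here from circuit
    elimination; conversely it gives strong elimination. *)

(** * Signed sets, sign by sign *)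

Section Side.
Context (E : finType).
Implicit Types (X Y Z : sset E) (e f : E) (s t : bool).

(** Signs are booleans, [true] for plus, so that statements symmetric under
    [opp] are proved once, with [~~ s] for the opposite sign. *)
Definition side s X : {set E} := if s then pos X else neg X.

Lemma side_opp s X : side s (opp X) = side (~~ s) X.
Proof. by case: s. Qed.

Lemma oppK : involutive (@opp E).
Proof. by move=> X; apply: sset_eqP. Qed.

Lemma supp_opp X : supp (opp X) = supp X.
Proof. by rewrite /supp /= setUC. Qed.

Lemma in_supp s f X :
  (f \in supp X) = (f \in side s X) || (f \in side (~~ s) X).
Proof. by rewrite in_setU; case: s => //=; rewrite orbC. Qed.

Lemma side_supp s f X : f \in side s X -> f \in supp X.
Proof. by rewrite (in_supp s) => ->. Qed.

Lemma suppP f X : f \in supp X -> exists s, f \in side s X.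
Proof. by rewrite (in_supp true) => /orP[]; [exists true | exists false]. Qed.

Lemma sideN s f X : f \in side s X -> f \notin side (~~ s) X.
Proof.
move=> fX; apply/negP => fX'; have := pred0P (pos_neg_disjoint X) f => /=.
by case: s fX fX' => /= -> ->.
Qed.

Lemma side_inj s t f X : f \in side s X -> f \in side t X -> s = t.
Proof. by move=> /sideN; case: s; case: t => //= /negP. Qed.

Lemma side_reorient (A : {set E}) X s f :
  (f \in side s (reorient_sset A X)) = (f \in side (s (+) (f \in A)) X).
Proof.
by case: s; rewrite ?in_pos_reorient ?in_neg_reorient; case: (f \in A).
Qed.

Lemma positiveP X : reflect (forall s f, f \in side s X -> s) (positive X).
Proof.
apply: (iffP eqP) => [X0 s f|sX]; first by case: s; rewrite //= X0 inE.
by apply/setP => f; rewrite inE; apply/negP => /(sX false).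
Qed.

End Side.

(** * The underlying matroid *)

Section Matroid.
Context (E : finType) (M : orientedMatroid E).
Implicit Types (X Y Z : sset E) (A I J K B S D : {set E}).
Implicit Types (e f : E) (s t : bool).

Local Notation C := (circuits M).

Lemma eliminate X Y s e : X \in C -> Y \in C -> X <> opp Y ->
  e \in side s X -> e \in side (~~ s) Y ->
  exists2 Z, Z \in C & e \notin supp Z /\
    forall t f, f \in side t Z -> (f \in side t X) || (f \in side t Y).
Proof.
wlog -> : X Y s / s = true => [wl | XC YC XY eX eY].
  case: s; first exact: wl.
  move=> XC YC XY eX eY; have [||||||Z ZC [eZ ZXY]] := wl Y X true => //.
    by move=> YX; apply: XY; rewrite YX oppK.
  by exists Z => //; split=> // t f /ZXY; rewrite orbC.
have [|Z ZC [Zp Zn]] := circuit_elimination (e := e) XC YC XY.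
  by rewrite in_setI eX.
exists Z => //; split=> [|t f].
  by rewrite in_setU; apply/norP; split; apply/negP;
    [move/(subsetP Zp) | move/(subsetP Zn)]; rewrite !inE eqxx.
by case: t => [/(subsetP Zp)|/(subsetP Zn)]; rewrite !inE => /andP[].
Qed.

Lemma circuit_orient X e s : X \in C -> e \in supp X ->
  exists2 Y, Y \in C & supp Y = supp X /\ e \in side s Y.
Proof.
move=> XC; rewrite (in_supp s) => /orP[eX|eX]; first by exists X.
by exists (opp X); rewrite ?circuit_opp // supp_opp side_opp.
Qed.

Lemma eliminate_supp X Y e : X \in C -> Y \in C -> supp X != supp Y ->
  e \in supp X -> e \in supp Y ->
  exists2 Z, Z \in C & supp Z \subset (supp X :|: supp Y) :\ e.
Proof.
move=> XC YC XY /suppP[s eX] /(circuit_orient (~~ s) YC)[Y' Y'C [sY' eY']].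
have [|Z ZC [eZ ZXY]] := eliminate XC Y'C _ eX eY'.
  by move=> eXY; rewrite eXY supp_opp sY' eqxx in XY.
exists Z => //; apply/subsetP => f fZ; rewrite in_setD1 in_setU.
rewrite (contraNneq _ eZ) => [|<- //] /=; have [t /ZXY] := suppP fZ.
by rewrite -sY' => /orP[]/side_supp ->; rewrite ?orbT.
Qed.

Lemma indepP I :
  reflect (forall X, X \in C -> ~~ (supp X \subset I)) (independent M I).
Proof. exact: forall_inP. Qed.

Lemma depP I : ~~ independent M I -> exists2 X, X \in C & supp X \subset I.
Proof. by rewrite negb_forall_in => /exists_inP[X XC /negPn]; exists X. Qed.

Lemma indep_circuit I X : independent M I -> X \in C -> ~~ (supp X \subset I).
Proof. by move/indepP; apply. Qed.

Lemma indepS I J : I \subset J -> independent M J -> independent M I.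
Proof.
move=> IJ /indepP indJ; apply/indepP => X /indJ.
by apply: contra => /subset_trans; apply.
Qed.

Lemma indep0 : independent M set0.
Proof.
by apply/indepP => X /circuit_neq0; apply: contra; rewrite subset0.
Qed.

Lemma circuit_supp_eq X Y : X \in C -> Y \in C -> supp X \subset supp Y ->
  supp X = supp Y.
Proof. by move=> XC YC /(circuit_incomparable XC YC)[-> | ->];
  rewrite ?supp_opp. Qed.

Lemma circuit_eq X Y s e : X \in C -> Y \in C -> supp X \subset supp Y ->
  e \in side s X -> e \in side s Y -> X = Y.
Proof.
move=> XC YC /(circuit_incomparable XC YC)[-> // | -> ].
by rewrite side_opp => eY /sideN; rewrite eY.
Qed.

Lemma circuitD1_indep X e : X \in C -> e \in supp X ->
  independent M (supp X :\ e).
Proof.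
move=> XC eX; apply/indepP => Y YC; apply/negP => YX.
have /(circuit_supp_eq YC XC) YE := subset_trans YX (subsetDl _ _).
by have := subsetP YX e; rewrite YE eX !inE eqxx => /(_ isT).
Qed.

Lemma fundamental_mem I X e : independent M I -> X \in C ->
  supp X \subset e |: I -> e \in supp X.
Proof.
move=> indI XC XI; apply: contraT => eX; case/negP: (indep_circuit indI XC).
apply/subsetP => f fX; have := subsetP XI f fX; rewrite in_setU1.
by case: eqVneq => // fe; rewrite -fe fX in eX.
Qed.

Lemma fundamental_unique I X Y e : independent M I -> X \in C -> Y \in C ->
  supp X \subset e |: I -> supp Y \subset e |: I -> supp X = supp Y.
Proof.
move=> indI XC YC XI YI; apply/eqP; apply: contraT => XY.
have [||Z ZC ZXY] := eliminate_supp XC YC XY (e := e).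
- exact: fundamental_mem XI.
- exact: fundamental_mem YI.
case/negP: (indep_circuit indI ZC); apply: subset_trans ZXY _.
by rewrite subDset subUset XI YI.
Qed.

(** Among the independent sets inside I and J larger than I, take K missing as
    little of I as possible, and let e be in I but not in K.  Exchanging e for
    any element f of K outside I must create a circuit; two of these circuits
    are distinct and contain e, and eliminating e leaves a circuit inside K. *)
Lemma indep_augment I J : independent M I -> independent M J -> #|I| < #|J| ->
  exists2 x, x \in J :\: I & independent M (x |: I).
Proof.
move=> indI indJ ltIJ; apply/exists_inP; apply: contraT.
rewrite negb_exists_in => /forall_inP maxI.
pose ok K := [&& independent M K, K \subset I :|: J & #|I| < #|K|].
have okJ : ok J by rewrite /ok indJ subsetUr.
case: (arg_minnP (fun K => #|I :\: K|) okJ) => K /and3P[indK sK ltIK] minK.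
have /subsetPn[e eI eK] : ~~ (I \subset K).
  apply/negP => IK; have [x xK xI] : exists2 x, x \in K & x \notin I.
    by apply/subsetPn; apply: contraTN ltIK => /subset_leq_card;
      rewrite -leqNgt.
  have /maxI/negP[] : x \in J :\: I by have := subsetP sK x xK;
    rewrite !inE (negPf xI).
  by apply: indepS indK; rewrite subUset sub1set xK.
have exC f : f \in K :\: I ->
    exists2 X, X \in C & supp X \subset e |: (K :\ f).
  rewrite inE => /andP[fI fK]; apply: depP; apply/negP => indf.
  have ef : e \notin K :\ f by rewrite !inE (negPf eK) andbF.
  have /minK : ok (e |: (K :\ f)).
    rewrite /ok indf cardsU1 ef (cardsD1 f K) fK in ltIK *.
    rewrite ltIK andbT subUset sub1set inE eI.
    exact: subset_trans (subsetDl _ _) sK.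
  rewrite leqNgt => /negP[]; apply: proper_card; apply/properP; split.
    apply/subsetP => g; rewrite !inE.
    have [-> | _] := eqVneq g f; first by rewrite (negPf fI) andbF.
    by case: (g \in K); rewrite ?orbT ?orbF /= => // /andP[_ ->].
  by exists e; rewrite !inE ?eqxx ?eI ?eK.
have eC f X : X \in C -> supp X \subset e |: (K :\ f) -> e \in supp X.
  by move=> XC; apply: fundamental_mem => //; apply: indepS indK;
    exact: subsetDl.
(* Two distinct circuits through e: one avoiding g, and, for h a common element
   of the first one and K outside I, one avoiding h. *)
have [g gK gI] : exists2 x, x \in K & x \notin I.
  by apply/subsetPn; apply: contraTN ltIK => /subset_leq_card; rewrite -leqNgt.
have [|X XC XK] := exC g; first by rewrite inE gI.
have /subsetPn[h hX hI] := indep_circuit indI XC.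
have hK : h \in K.
  have := subsetP XK h hX; rewrite !inE => /orP[/eqP he|/andP[]//].
  by rewrite he eI in hI.
have [|Y YC YK] := exC h; first by rewrite inE hI.
have XY : supp X != supp Y.
  apply: contraTneq hX => ->; apply/negP => /(subsetP YK).
  by rewrite !inE eqxx orbF => /eqP he; rewrite he eI in hI.
have [Z ZC ZXY] := eliminate_supp XC YC XY (eC _ _ XC XK) (eC _ _ YC YK).
case/negP: (indep_circuit indK ZC); apply: subset_trans ZXY _.
by rewrite subDset subUset !(subset_trans XK, subset_trans YK) // setUS
  ?subsetDl.
Qed.

Lemma rk_witness A :
  exists I, [/\ independent M I, I \subset A & #|I| = rk M A].
Proof.
have [|I /andP[indI IA] rkE] := @eq_bigmax_cond _
  (fun I => independent M I && (I \subset A)) (fun I => #|I|).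
  by apply/card_gt0P; exists set0; rewrite unfold_in indep0 sub0set.
by exists I; rewrite -rkE.
Qed.

Lemma rk_ge A I : independent M I -> I \subset A -> #|I| <= rk M A.
Proof.
move=> indI IA; apply: (@leq_bigmax_cond _ _ (fun I : {set E} => #|I|)).
by rewrite indI IA.
Qed.

Lemma indep_extend A I : independent M I -> I \subset A ->
  exists J, [/\ independent M J, I \subset J, J \subset A & #|J| = rk M A].
Proof.
move=> indI IA; pose ok J := [&& independent M J, I \subset J & J \subset A].
have okI : ok I by rewrite /ok indI subxx.
case: (arg_maxnP (fun J => #|J|) okI) => J /and3P[indJ IJ JA] maxJ.
exists J; split=> //; apply/eqP; rewrite eqn_leq rk_ge //= leqNgt.
have [K [indK KA <-]] := rk_witness A; apply/negP => /(indep_augment indJ indK).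
case=> x; rewrite inE => /andP[xJ xK] indx; have /maxJ : ok (x |: J).
  by rewrite /ok indx subUset sub1set (subsetP KA) // JA (subset_trans IJ)
    ?subsetUr.
by rewrite /= cardsU1 xJ ltnn.
Qed.

Lemma rk_max A J x : independent M J -> J \subset A -> #|J| = rk M A ->
  x \in A -> independent M (x |: J) -> x \in J.
Proof.
move=> indJ JA rkJ xA indx; apply: contraT => xJ.
have := rk_ge indx (A := A); rewrite cardsU1 xJ rkJ ltnn subUset sub1set xA JA.
by move=> /(_ isT).
Qed.

Lemma rkS A B : A \subset B -> rk M A <= rk M B.
Proof.
by have [I [indI IA <-]] := rk_witness A; move/(subset_trans IA); apply: rk_ge.
Qed.

Lemma rkU1 A e : e \notin A ->
  rk M (e |: A) = rk M A +
    ~~ [exists X in C, (e \in supp X) && (supp X \subset e |: A)].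
Proof.
move=> eA; case: (boolP [exists X in C, _]) =>
  [/exists_inP[X XC /andP[eX XA]] | noX] /=.
  apply/eqP; rewrite addn0 eqn_leq [X in _ && X]rkS ?subsetUr // andbT leqNgt.
  have [||J [indJ XJ JA rkJ]] := @indep_extend A (supp X :\ e).
  - exact: circuitD1_indep.
  - by rewrite subDset.
  have [K [indK KA <-]] := rk_witness (e |: A).
  rewrite -rkJ; apply/negP => /(indep_augment indJ indK)[x].
  rewrite inE => /andP[xJ /(subsetP KA)];
    rewrite !inE => /orP[/eqP -> | xA indx].
    move=> ind; case/negP: (indep_circuit ind XC).
    by rewrite -(setD1K eX) setUS.
  by rewrite (rk_max indJ JA rkJ xA indx) in xJ.
apply/eqP; rewrite eqn_leq; apply/andP; split.
  have [K [indK KA <-]] := rk_witness (e |: A).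
  rewrite (cardsD1 e K) addnC leq_add ?leq_b1 // rk_ge ?subDset //.
  by apply: indepS indK; apply: subsetDl.
have [I [indI IA <-]] := rk_witness A.
have eI : e \notin I by apply: contra eA; apply: (subsetP IA).
rewrite addn1 -[_.+1]/(1 + #|I|) -[1]/(nat_of_bool true) -eI -cardsU1.
apply: rk_ge; last by rewrite setUS.
apply/indepP => X XC; apply: contra noX => XI; apply/exists_inP; exists X => //.
by rewrite (fundamental_mem indI XC XI) (subset_trans XI) ?setUS.
Qed.

End Matroid.

(** * Hyperplanes and their fundamental circuits *)

Section Cocircuit.
Context (E : finType) (M : orientedMatroid E).
Implicit Types (X Y Z U : sset E) (A I J K B S D : {set E}).
Implicit Types (a b e f : E) (s t : bool).

Local Notation C := (circuits M).

Lemma basis_rk B : basis M B = independent M B && (#|B| == rk M setT).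
Proof.
apply/maxsetP/andP => [[indB maxB] | [indB /eqP rkB]]; split=> //.
  have [J [indJ BJ _ <-]] := indep_extend indB (subsetT B).
  by rewrite (maxB _ indJ BJ).
move=> J indJ BJ; apply/esym/eqP; rewrite eqEcard BJ rkB; exact: rk_ge.
Qed.

Lemma cocircuit_meets_basis D B :
  matroid_cocircuit M D -> basis M B -> exists2 e, e \in D & e \in B.
Proof.
move=> /minsetp/forallP/(_ B) /implyP meet /meet /set0Pn[e].
by rewrite inE => /andP[]; exists e.
Qed.

(** Minimality of D: some basis avoids D except for e. *)
Lemma cocircuit_meets_once D e : matroid_cocircuit M D -> e \in D ->
  exists2 B, basis M B & B :\ e \subset ~: D /\ e \in B.
Proof.
move=> cD eD; have /minsetP[_ minD] := cD.
have : ~~ [forall B, basis M B ==> ((D :\ e) :&: B != set0)].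
  apply/negP => /minD/(_ (subsetDl _ _)) DE.
  by move: eD; rewrite -DE !inE eqxx.
case/forallPn => B; rewrite negb_imply negbK => /andP[bB /eqP dB].
have BeD f : f \in B -> f \in D -> f = e.
  move=> fB fD; apply/eqP; apply: contraT => fe.
  by have := in_set0 f; rewrite -dB !inE fe fD fB.
exists B => //; split.
  apply/subsetP => f; rewrite !inE => /andP[fe fB].
  by apply: contraNN fe => /(BeD _ fB)->.
by have [f fD fB] := cocircuit_meets_basis cD bB; rewrite -(BeD f).
Qed.

Lemma cocircuit_rk D : matroid_cocircuit M D -> rk M setT = (rk M (~: D)).+1.
Proof.
move=> cD; have [I [indI sI rkI]] := rk_witness M setT.
have bI : basis M I by rewrite basis_rk indI rkI eqxx.
have [e eD _] := cocircuit_meets_basis cD bI.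
have [B bB [BD eB]] := cocircuit_meets_once cD eD.
have := bB; rewrite basis_rk => /andP[indB /eqP rkB].
apply/eqP; rewrite eqn_leq -{1}rkB (cardsD1 e B) eB add1n ltnS.
rewrite rk_ge ?(indepS _ indB) ?subsetDl //= ltnNge; apply/negP => ge.
have [J [indJ JD rkJ]] := rk_witness M (~: D).
have bJ : basis M J.
  by rewrite basis_rk indJ rkJ eqn_leq ge rkS.
have [f fD /(subsetP JD)] := cocircuit_meets_basis cD bJ.
by rewrite inE fD.
Qed.

(** The complement of a cocircuit is a hyperplane; this is a basis of it. *)
Definition hyperbasis D B :=
  [&& independent M B, B \subset ~: D & #|B| == rk M (~: D)].

Lemma hyperbasis_extend D I : independent M I -> I \subset ~: D ->
  exists2 B, hyperbasis D B & I \subset B.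
Proof.
move=> indI /(indep_extend indI)[B [indB IB BD rkB]].
by exists B => //; rewrite /hyperbasis indB BD rkB eqxx.
Qed.

(** Augment B from a basis that meets D in e only: the new element cannot lie in
    the hyperplane, where B is maximal, so it is e. *)
Lemma hyperbasisU1 D B e : matroid_cocircuit M D -> hyperbasis D B -> e \in D ->
  independent M (e |: B).
Proof.
move=> cD /and3P[indB BD /eqP rkB] eD.
have [B0 bB0 [B0D eB0]] := cocircuit_meets_once cD eD.
move: bB0; rewrite basis_rk (cocircuit_rk cD) -rkB => /andP[indB0 /eqP rkB0].
have [|x] := indep_augment indB indB0; first by rewrite rkB0.
rewrite inE => /andP[xB xB0] indx; have [<- // | xe] := eqVneq x e.
suff: x \in B by rewrite (negPf xB).
apply: rk_max rkB _ indx => //; apply: (subsetP B0D).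
by rewrite !inE xe.
Qed.

(** If X met D in e only, the rest of X would extend to a basis B of the
    hyperplane, and B + e would be an independent set containing X. *)
Lemma circuit_cocircuit_inter D X e : matroid_cocircuit M D -> X \in C ->
  e \in supp X -> e \in D -> exists2 f, f != e & f \in supp X :&: D.
Proof.
move=> cD XC eX eD; apply/exists_inP; apply: contraT.
rewrite negb_exists_in => /forall_inP single.
have XD : supp X :\ e \subset ~: D.
  apply/subsetP => f; rewrite in_setD1 in_setC => /andP[fe fX].
  by apply: contraNN (single f fe) => fD; rewrite in_setI fX.
have [B hB XB] := hyperbasis_extend (circuitD1_indep XC eX) XD.
case/negP: (indep_circuit (hyperbasisU1 cD hB eD) XC).
by rewrite -subDset.
Qed.

Lemma hyperbasis_circuit D B e f s : matroid_cocircuit M D -> hyperbasis D B ->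
  e \in D -> f \in D -> e != f ->
  exists2 X, X \in C & supp X \subset e |: (f |: B) /\ e \in side s X.
Proof.
move=> cD hB eD fD ef; have indf := hyperbasisU1 cD hB fD.
have /and3P[indB BD /eqP rkB] := hB.
have notin g : g \in D -> g \notin B.
  by move=> gD; apply: contraTN gD => /(subsetP BD); rewrite inE.
have [|X XC XB] := depP (M := M) (I := e |: (f |: B)).
  apply/negP => ind; have := rk_ge ind (subsetT _).
  rewrite !cardsU1 !inE (negPf ef) !notin // rkB (cocircuit_rk cD).
  by rewrite add1n ltnn.
have [Y YC [YX eY]] := circuit_orient s XC (fundamental_mem indf XC XB).
by exists Y => //; rewrite YX.
Qed.

(** For e and f in the cocircuit D, the signs of the circuit in B + e + f decide
    whether e and f have equal or opposite signs in D.  This does not depend on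
    the basis B of the hyperplane.  For one exchange of a for b: if X and X' had
    the same sign at e but not at f, eliminating e between X and -X', and f
    between X and X', would both produce the circuit in B + b, with a of the
    same sign and b of opposite signs. *)
Lemma signature_exchange D B a b X X' s t e f : matroid_cocircuit M D ->
  a \in B -> b \notin B -> hyperbasis D B -> hyperbasis D (b |: (B :\ a)) ->
  e \in D -> f \in D -> e != f -> X \in C -> X' \in C ->
  supp X \subset e |: (f |: B) -> supp X' \subset e |: (f |: (b |: (B :\ a))) ->
  e \in side s X -> e \in side s X' -> f \in side t X -> f \in side t X'.
Proof.
set B' := b |: _ => cD aB bB hB hB' eD fD ef XC X'C XB XB' eX eX' fX.
have /and3P[indB BD _] := hB; have /and3P[indB' B'D _] := hB'.
apply: contraT => fX't.
have fX' : f \in side (~~ t) X'.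
  suff: f \in supp X' by rewrite (in_supp t) (negPf fX't).
  apply: (@fundamental_mem _ M (e |: B')) => //;
    first exact: hyperbasisU1 hB' _.
  by rewrite setUCA.
have notsub : ~~ (supp X \subset supp X').
  by apply: contra fX't => XX'; rewrite -(circuit_eq XC X'C XX' eX eX').
have neX : X <> X' by move=> XX'; rewrite XX' subxx in notsub.
have neN : X <> opp X' by move=> XX'; rewrite XX' supp_opp subxx in notsub.
have BnD g : g \in D -> g \notin B :|: B'.
  by apply: contraL => gB; rewrite -in_setC; apply: subsetP gB;
    rewrite subUset BD.
have neq g h : g \in D -> h \in B :|: B' -> (h == g) = false.
  by move=> gD; apply: contraTF => /eqP ->; apply: BnD.
have aU : a \in B :|: B' by rewrite in_setU aB.
have bU : b \in B :|: B' by rewrite in_setU setU11 orbT.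
have bB' : b \in B' by rewrite setU11.
have ab : a != b by apply: contraNneq bB => <-.
have aB' : a \notin B' by rewrite !inE eqxx (negPf ab).
have aX : a \in supp X.
  apply: contraNT notsub => aX; have XB2 : supp X \subset e |: (f |: B').
    apply/subsetP => g gX; have := subsetP XB g gX; rewrite !inE.
    case/or3P=> -> ; rewrite ?orbT // andbT.
    by rewrite (_ : g != a) ?orbT //; apply: contraNneq aX => <-.
  by rewrite (fundamental_unique (hyperbasisU1 cD hB' fD) XC X'C XB2 XB').
have bX' : b \in supp X'.
  apply: contraNT notsub => bX'; have XB2 : supp X' \subset e |: (f |: B).
    apply/subsetP => g gX; have := subsetP XB' g gX; rewrite !inE.
    case/or4P=> [->|->|/eqP gb|/andP[_ ->]]; rewrite ?orbT //.
    by rewrite -gb gX in bX'.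
  by rewrite (fundamental_unique (hyperbasisU1 cD hB fD) XC X'C XB XB2).
have aX' : a \notin supp X'.
  apply/negP => /(subsetP XB'); rewrite 2!in_setU1.
  by rewrite (negPf aB') !neq.
have bX : b \notin supp X.
  apply/negP => /(subsetP XB); rewrite !in_setU1.
  by rewrite (negPf bB) !neq.
(* An eliminated circuit meets D in at most one element, hence not at all. *)
have inbB Z g : Z \in C -> g \notin supp Z -> (g == e) || (g == f) ->
    supp Z \subset supp X :|: supp X' -> supp Z \subset b |: B.
  move=> ZC gZ gef ZXX'.
  have ZB : supp Z \subset e |: (f |: (b |: B)).
    apply: subset_trans ZXX' _; rewrite subUset (subset_trans XB)
      ?(subset_trans XB') //.
      by rewrite !setUS // subsetDl.
    by rewrite !setUS // subsetUr.
  have ZD h : h \in supp Z -> h \in D -> False.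
    move=> hZ hD; have [k kh] := circuit_cocircuit_inter cD ZC hZ hD.
    rewrite in_setI => /andP[kZ kD].
    have ef_only l : l \in supp Z -> l \in D -> (l == e) || (l == f).
      move=> lZ lD; have := subsetP ZB l lZ;
        rewrite !in_setU1 [l == b]eq_sym (neq l b lD bU) //=.
      by have := BnD l lD; rewrite in_setU negb_or => /andP[/negPf->];
        rewrite orbF.
    have gh : (g == h) = false by apply: contraNF gZ => /eqP ->.
    have gk : (g == k) = false by apply: contraNF gZ => /eqP ->.
    move: gef gh gk kh; case/orP: (ef_only _ hZ hD) => /eqP ->;
      by case/orP: (ef_only _ kZ kD) => /eqP ->; case/orP => /eqP ->;
        rewrite !eqxx.
  apply/subsetP => h hZ; have := subsetP ZB h hZ; rewrite !in_setU1.
  case/or4P => [/eqP he|/eqP hf|->//|->]; rewrite ?orbT //.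
    by case: (ZD h); rewrite ?he // -he.
  by case: (ZD h); rewrite ?hf // -hf.
have sub_union Z Y : supp Y = supp X' ->
    (forall t f, f \in side t Z -> (f \in side t X) || (f \in side t Y)) ->
    supp Z \subset supp X :|: supp X'.
  move=> sY ZXY; apply/subsetP => g /suppP[r /ZXY]; rewrite in_setU -sY.
  by case/orP => /side_supp ->; rewrite ?orbT.
have eoX' : e \in side (~~ s) (opp X') by rewrite side_opp negbK.
have neX2 : X <> opp (opp X') by rewrite oppK.
have [Z ZC [eZ ZXX']] := eliminate XC (circuit_opp X'C) neX2 eX eoX'.
have [Z' Z'C [fZ' Z'XX']] := eliminate XC X'C neN fX fX'.
have Zb : supp Z \subset b |: B.
  by apply: (inbB _ e ZC eZ); rewrite ?eqxx // (sub_union _ _ (supp_opp X')).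
have Z'b : supp Z' \subset b |: B.
  by apply: (inbB _ f Z'C fZ'); rewrite ?eqxx ?orbT // (sub_union _ X').
have aW W : W \in C -> supp W \subset b |: B -> a \in supp W.
  move=> WC Wb; apply: contraT => aW; case/negP: (indep_circuit indB' WC).
  apply/subsetP => g gW; have := subsetP Wb g gW;
    rewrite !inE => /orP[-> // | ->].
  by rewrite andbT orbC (contraNneq _ aW) // => <-.
have bW W := fundamental_mem (M := M) (e := b) (X := W) indB.
have [p aXp] := suppP aX; have [q bXq] := suppP bX'.
have signa W Y : supp Y = supp X' -> W \in C -> supp W \subset b |: B ->
    (forall t f, f \in side t W -> (f \in side t X) || (f \in side t Y)) ->
    a \in side p W.
  move=> sY WC Wb WXY; have [r ar] := suppP (aW _ WC Wb).
  have /orP[ar' | /side_supp] := WXY _ _ ar;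
    first by rewrite (side_inj aXp ar').
  by rewrite sY (negPf aX').
have signb W Y r : b \in side r Y -> W \in C -> supp W \subset b |: B ->
    (forall t f, f \in side t W -> (f \in side t X) || (f \in side t Y)) ->
    b \in side r W.
  move=> br WC Wb WXY; have [r' br'] := suppP (bW _ WC Wb).
  have /orP[/side_supp | br2] := WXY _ _ br'; first by rewrite (negPf bX).
  by rewrite (side_inj br br2).
have bXq' : b \in side (~~ q) (opp X') by rewrite side_opp negbK.
have := circuit_eq ZC Z'C _ (signa _ _ (supp_opp X') ZC Zb ZXX')
  (signa _ _ erefl Z'C Z'b Z'XX').
rewrite (fundamental_unique indB ZC Z'C Zb Z'b) subxx => /(_ isT) ZZ'.
have := signb _ _ _ bXq Z'C Z'b Z'XX' => /sideN.
by rewrite -ZZ' (signb _ _ _ bXq' ZC Zb ZXX').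
Qed.

Lemma signature_basis D B B' X X' s t e f : matroid_cocircuit M D ->
  hyperbasis D B -> hyperbasis D B' ->
  e \in D -> f \in D -> e != f -> X \in C -> X' \in C ->
  supp X \subset e |: (f |: B) -> supp X' \subset e |: (f |: B') ->
  e \in side s X -> e \in side s X' -> f \in side t X -> f \in side t X'.
Proof.
move=> cD; have [n] := ubnP #|B :\: B'|; elim: n B X => // n IHn B X ltBn.
move=> hB hB' eD fD ef XC X'C XB X'B' eX eX' fX.
have /and3P[indB BD /eqP rkB] := hB; have /and3P[indB' B'D /eqP rkB'] := hB'.
have [BB' | /subsetPn[a aB aB']] := boolP (B \subset B').
  have BE : B = B' by apply/eqP; rewrite eqEcard BB' rkB rkB' /=.
  rewrite -(circuit_eq XC X'C _ eX eX') //.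
  rewrite BE in XB; by rewrite (fundamental_unique (hyperbasisU1 cD hB' fD) XC
    X'C XB X'B').
have [||b] := indep_augment (I := B :\ a) _ indB'.
- by apply: indepS indB; apply: subsetDl.
- by rewrite rkB' -rkB [X in _ < X](cardsD1 a) aB.
rewrite !inE negb_and negbK => /andP[/orP[/eqP ba|bB] bB'] ind1.
  by rewrite -ba bB' in aB'.
have hB1 : hyperbasis D (b |: (B :\ a)).
  rewrite /hyperbasis ind1 subUset sub1set (subsetP B'D) // (subset_trans
    (subsetDl _ _)) //=.
  by rewrite cardsU1 !inE (negPf bB) andbF /= -rkB (cardsD1 a B) aB.
have [X1 X1C [X1B eX1]] := hyperbasis_circuit s cD hB1 eD fD ef.
have fX1 := signature_exchange cD aB bB hB hB1 eD fD ef XC X1C XB X1B eX eX1 fX.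
have ltB1 : #|(b |: (B :\ a)) :\: B'| < n.
  rewrite ltnS in ltBn; apply: leq_trans ltBn; apply: proper_card.
  apply/properP; split; last first.
    by exists a; rewrite !inE ?aB ?aB' // eqxx /= orbF;
      apply: contraNneq bB => <-.
  apply/subsetP => g; rewrite !inE => /andP[gB' /orP[/eqP gb|/andP[_ ->]]].
    by rewrite gb bB' in gB'.
  by rewrite gB'.
exact: IHn ltB1 hB1 hB' eD fD ef X1C X'C X1B X'B' eX1 eX' fX1.
Qed.

End Cocircuit.

(** * Signing the cocircuits *)

Section Painting.
Context (E : finType) (M : orientedMatroid E).
Implicit Types (X Y Z U : sset E) (A I J K B S D : {set E}).
Implicit Types (a b e f : E) (s t : bool).

Local Notation C := (circuits M).

Lemma orthogonalP X U : reflect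
  ((exists s e, e \in side s X /\ e \in side s U) <->
   (exists s e, e \in side s X /\ e \in side (~~ s) U)) (orthogonal X U).
Proof.
have agreeP : (exists s e, e \in side s X /\ e \in side s U) <->
    (pos X :&: pos U) :|: (neg X :&: neg U) != set0.
  split=> [[s [e [eX eU]]]|/set0Pn[e]].
    by apply/set0Pn; exists e; rewrite !inE; case: s eX eU => /= -> ->;
      rewrite ?orbT.
  rewrite !inE => /orP[]/andP[eX eU]; first by exists true, e.
  by exists false, e.
have disagreeP : (exists s e, e \in side s X /\ e \in side (~~ s) U) <->
    (pos X :&: neg U) :|: (neg X :&: pos U) != set0.
  split=> [[s [e [eX eU]]]|/set0Pn[e]].
    by apply/set0Pn; exists e; rewrite !inE; case: s eX eU => /= -> ->;
      rewrite ?orbT.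
  rewrite !inE => /orP[]/andP[eX eU]; first by exists true, e.
  by exists false, e.
apply: (iffP eqP) => [H | H].
  by apply: (iff_trans agreeP); rewrite H; apply: iff_sym.
by apply: negb_inj; apply/idP/idP => ?;
  [apply/disagreeP/H/agreeP | apply/agreeP/H/disagreeP].
Qed.

Lemma orthogonal_oppr X U : orthogonal X U -> orthogonal X (opp U).
Proof.
move=> /orthogonalP[H1 H2]; apply/orthogonalP; split=> -[s [e [eX]]].
  rewrite side_opp => eU; have [|r [g [gX gU]]] := H2; first by exists s, e.
  by exists r, g; rewrite side_opp negbK.
rewrite side_opp negbK => eU; have [|r [g [gX gU]]] := H1; first by exists s, e.
by exists r, g; rewrite side_opp.
Qed.

Definition agrees_on D X U := forall t f, f \in side t X -> f \in D -> f \in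
  side t U.

(** Fix e0 in D and a basis B0 of the hyperplane, give e0 sign plus, and give
    f in D the sign opposite to that of f in the circuit of B0 + e0 + f that is
    positive at e0.  Suppose a circuit X agrees with this signature on all of D.
    Take e in X and D other than e0, a basis B of the hyperplane containing the
    part of X in it, and eliminate e between X and the circuit of B + e0 + e:
    the result still agrees with the signature on D, it meets D because B is
    independent, and it has fewer elements in D - e0.  Repeating this
    contradicts [circuit_cocircuit_inter]. *)
Lemma cocircuit_signature D : matroid_cocircuit M D ->
  exists2 U, supp U = D & forall X, X \in C -> orthogonal X U.
Proof.
move=> cD; have [B0 hB0 _] := hyperbasis_extend (indep0 M) (sub0set (~: D)).
have [e0 e0D] : exists e0, e0 \in D.
  have [I [indI sI rkI]] := rk_witness M setT.
  have [|e eD _] := cocircuit_meets_basis cD (B := I); last by exists e.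
  by rewrite basis_rk indI rkI eqxx.
pose S s := [set f in D | if f == e0 then s else
  [exists X in C, [&& supp X \subset e0 |: (f |: B0), e0 \in side true X
     & f \in side (~~ s) X]]].
have SP f s : f != e0 -> reflect (f \in D /\ exists2 X, X \in C &
    [/\ supp X \subset e0 |: (f |: B0), e0 \in side true X
      & f \in side (~~ s) X])
    (f \in S s).
  move=> fe0; rewrite inE (negPf fe0); apply: (iffP andP) => -[fD].
    by case/exists_inP=> X XC /and3P[]; split=> //; exists X.
  by case=> X XC [XB eX fX]; split=> //; apply/exists_inP; exists X;
    rewrite // XB eX.
have dS : [disjoint S true & S false].
  apply/pred0P => f /=; apply/negbTE/negP => /andP[].
  have [-> | fe0] := eqVneq f e0; first by rewrite !inE eqxx andbF.
  move=> /(SP _ _ fe0)[fD [X XC [XB eX fX]]] /(SP _ _ fe0)[_ [Y YC [YB eY fY]]].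
  rewrite eq_sym in fe0; have := signature_basis cD hB0 hB0 e0D fD fe0 XC YC XB
    YB eX eY fX.
  by apply/negP/(sideN fY).
pose U := @SSet E (_, _) dS; have UE s : side s U = S s by case: s.
have posU : e0 \in side true U by rewrite UE !inE eqxx e0D.
have suppU : supp U = D.
  apply/setP => f; rewrite (in_supp true) !UE.
  have [-> | fe0] := eqVneq f e0; first by rewrite !inE eqxx e0D.
  apply/orP/idP => [[]/(SP _ _ fe0)[] // | fD]; rewrite eq_sym in fe0.
  have [X XC [XB eX]] := hyperbasis_circuit true cD hB0 e0D fD fe0.
  have [|t fX] := @suppP _ f X.
    by apply: (@fundamental_mem _ M (e0 |: B0));
      rewrite // ?(hyperbasisU1 cD) // setUCA.
  have : f \in S (~~ t).
    apply/SP; rewrite eq_sym // in fe0 *; split=> //; exists X => //.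
    by rewrite negbK.
  by case: (t); [right | left].
exists U => //.
(* By independence of the basis, B0 may be replaced by any other one. *)
have key B f s : hyperbasis M D B -> f != e0 -> f \in side s U -> exists2 Y, Y
  \in C &
    [/\ supp Y \subset e0 |: (f |: B), e0 \in side true Y
      & f \in side (~~ s) Y].
  move=> hB fe0; rewrite UE => /(SP _ _ fe0)[fD [X XC [XB eX fX]]].
  have e0f : e0 != f by rewrite eq_sym.
  have [Y YC [YB eY]] := hyperbasis_circuit true cD hB e0D fD e0f.
  exists Y => //; split=> //.
  exact: signature_basis cD hB0 hB e0D fD e0f XC YC XB YB eX eY fX.
have noagree X e : X \in C -> e \in supp X -> e \in D -> ~ agrees_on D X U.
  have [n] := ubnP #|(supp X :&: D) :\ e0|; elim: n X e => // n IHn X e'.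
  rewrite ltnS => leXn XC e'X e'D agrX.
  have [e ee0] : exists2 e, e != e0 & e \in supp X :&: D.
    have [<- | ne'] := eqVneq e' e0;
      first exact: circuit_cocircuit_inter cD XC e'X e'D.
    by exists e'; rewrite // in_setI e'X.
  rewrite in_setI => /andP[eX eD]; have [s esX] := suppP eX.
  have indX : independent M (supp X :\: D).
    apply: indepS (circuitD1_indep XC eX).
    by apply/subsetP => f; rewrite in_setD in_setD1 => /andP[fD ->];
      rewrite andbT;
      apply: contraNneq fD => ->.
  have [|B hB XB] := hyperbasis_extend indX (D := D).
    by apply/subsetP => f; rewrite in_setD in_setC => /andP[].
  have /and3P[indB BD _] := hB.
  have [Y YC [YB eY fY]] := key B e s hB ee0 (agrX _ _ esX eD).
  have XY : X <> opp Y.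
    move=> XY; have /agrX/(_ e0D) : e0 \in side false X by rewrite XY side_opp.
    by apply/negP/(sideN posU).
  have [Z ZC [eZ ZXY]] := eliminate XC YC XY esX fY.
  have YD f : f \in supp Y -> f != e -> (f == e0) || (f \in B).
    by move/(subsetP YB); rewrite !in_setU1 => /or3P[->|->|->]; rewrite ?orbT.
  have Zne f : f \in supp Z -> f != e by apply: contraTneq => ->.
  have /subsetPn[f fZ fB] := indep_circuit indB ZC.
  have fD : f \in D.
    have [r /ZXY/orP[fX|/side_supp/YD]] := suppP fZ.
      apply: contraNT fB => fD; apply: (subsetP XB).
      by rewrite in_setD fD (side_supp fX).
    by move/(_ (Zne f fZ)); rewrite (negPf fB) orbF => /eqP ->.
  have YZD r g : g \in side r Y -> g \in supp Z -> g \in D ->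
      g = e0 /\ r = true.
    move=> gY gZ gD; have := YD g (side_supp gY) (Zne g gZ).
    rewrite orbC => /orP[/(subsetP BD)|/eqP ge0]; first by rewrite in_setC gD.
    by split=> //; apply: (side_inj gY); rewrite ge0.
  apply: (IHn Z f) => // [|r g gZ gD].
    apply: leq_trans leXn; apply: proper_card; apply/properP; split.
      apply/subsetP => g; rewrite !in_setD1 !in_setI => /and3P[ge0 gZ gD].
      rewrite ge0 gD andbT /=; have [r gr] := suppP gZ.
      case/orP: (ZXY _ _ gr) => [/side_supp // | /YZD/(_ gZ gD)[gE _]].
      by rewrite gE eqxx in ge0.
    by exists e; rewrite in_setD1 in_setI ?eX ?eD ?ee0 // (negPf eZ) andbF.
  case/orP: (ZXY _ _ gZ) => [gX | gY]; first exact: agrX.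
  by have [-> ->] := YZD r g gY (side_supp gZ) gD.
have sideU f t : f \in D -> (f \notin side (~~ t) U) = (f \in side t U).
  rewrite -suppU (in_supp t) => /orP[fU|fU]; first by rewrite fU sideN.
  by rewrite fU; apply/esym/negbTE; have := sideN fU; rewrite negbK.
have side1 X s e : X \in C -> e \in side s X -> e \in side s U ->
    exists t f, f \in side t X /\ f \in side (~~ t) U.
  move=> XC eX eU; have [/existsP[t /exists_inP[f fX fU]]|] :=
    boolP [exists t, exists f in side t X, f \in side (~~ t) U];
      first by exists t, f.
  rewrite negb_exists => /forallP none; case: (noagree X e XC).
  - exact: side_supp eX.
  - by rewrite -suppU (side_supp eU).
  move=> t f fX fD; rewrite -sideU //.
  by have := none t; rewrite negb_exists_in => /forall_inP; apply.
move=> X XC; apply/orthogonalP; split=> -[s [e [eX eU]]]; first exact: side1 eU.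
have [||t [f [fX fU]]] := side1 (opp X) (~~ s) e _ _ eU;
  first exact: circuit_opp.
  by rewrite side_opp negbK.
by exists (~~ t), f; rewrite -side_opp.
Qed.

(** * Painting and strong elimination *)

Lemma cocircuitsP U : reflect (matroid_cocircuit M (supp U) /\
  forall X, X \in C -> orthogonal X U) (U \in cocircuits M).
Proof. by rewrite inE; apply: (iffP andP) => -[cU /forall_inP]. Qed.

Lemma cocircuit_opp U : U \in cocircuits M -> opp U \in cocircuits M.
Proof.
move=> /cocircuitsP[cU oU]; apply/cocircuitsP; rewrite supp_opp;
  split=> // X XC.
exact/orthogonal_oppr/oU.
Qed.

(** Without such a circuit, e can be added to a basis I of K; for a basis B of
    the matroid containing I + e, the fundamental cocircuit of e avoids K. *)
Lemma matroid_painting e K : e \notin K ->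
  (exists2 X, X \in C & e \in supp X /\ supp X \subset e |: K) \/
  (exists2 D, matroid_cocircuit M D & e \in D /\ D \subset ~: K).
Proof.
move=> eK; have [I [indI IK rkI]] := rk_witness M K.
have eI : e \notin I by apply: contra eK; apply: (subsetP IK).
have [ind | /depP[X XC XI]] := boolP (independent M (e |: I)); last first.
  left; exists X => //; rewrite (fundamental_mem indI XC XI); split=> //.
  by rewrite (subset_trans XI) ?setUS.
right; have [B [indB IB _ rkB]] := indep_extend ind (subsetT _).
have eB : e \in B by rewrite (subsetP IB) ?setU11.
pose D := [set x | (x \notin B :\ e) && independent M (x |: (B :\ e))].
have card1 x : x \notin B :\ e -> #|x |: (B :\ e)| = rk M setT.
  by move=> xB; rewrite cardsU1 xB -rkB [RHS](cardsD1 e) eB.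
exists D; last split.
- apply/minsetP; split=> [|D' /forallP meet D'D].
    apply/forallP => B'; apply/implyP;
      rewrite basis_rk => /andP[indB' /eqP rkB'].
    have [||x] := indep_augment (I := B :\ e) _ indB'.
    - by apply: indepS indB; apply: subsetDl.
    - by rewrite rkB' -rkB [X in _ < X](cardsD1 e) eB.
    rewrite in_setD => /andP[xB xB'] indx; apply/set0Pn; exists x.
    by rewrite in_setI xB' inE xB indx.
  apply/eqP; rewrite eqEsubset D'D; apply/subsetP => x.
  rewrite inE => /andP[xB indx]; have /implyP := meet (x |: (B :\ e)).
  rewrite basis_rk indx card1 // eqxx => /(_ isT)/set0Pn[y].
  rewrite in_setI => /andP[yD']; rewrite in_setU1 => /orP[/eqP <- // | yB].
  by have := subsetP D'D y yD'; rewrite inE yB.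
- by rewrite inE setD1K // indB in_setD1 eqxx.
apply/subsetP => x; rewrite inE in_setC => /andP[xB indx];
  apply: contraNN xB => xK.
have IBe : I \subset B :\ e.
  by rewrite subsetD1 eI (subset_trans _ IB) // subsetUr.
apply: (subsetP IBe); apply: (rk_max indI IK rkI xK).
by apply: indepS indx; rewrite setUS.
Qed.

(** Minty's painting lemma.  P s is the set of elements at which a circuit may
    have sign s; the cocircuit may have sign s exactly where a circuit may not
    have sign [~~ s], so that on the painted elements a circuit and a cocircuit
    obeying the pattern never disagree.  Induction on the number of elements g
    other than e with exactly one allowed sign: forbid both signs at g, or
    allow both.  If this gives a cocircuit U in the first case and a circuit X
    in the second, they agree at e, so they disagree somewhere, which can only
    be at g; hence one of the two has an allowed sign at g. *)
Lemma painting (P : bool -> {set E}) e s :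
  (exists2 X, X \in C & e \in side s X /\
     forall t f, f != e -> f \in side t X -> f \in P t) \/
  (exists2 U, U \in cocircuits M & e \in side s U /\
     forall t f, f != e -> f \in side t U -> f \notin P (~~ t)).
Proof.
have [n] := ubnP #|[set f | (f != e) && ((f \in P (~~ s)) (+) (f \in P s))]|.
elim: n P => // n IHn P; rewrite ltnS => leP.
have [/exists_inP[g ge gP] | ] :=
    boolP [exists g in [pred g | g != e], (g \in P (~~ s)) (+) (g \in P s)];
      last first.
  rewrite negb_exists_in => /forall_inP sameP.
  have PE t f : f != e -> (f \in P t) = (f \in P s).
    move=> /sameP; rewrite negb_add => /eqP Ps.
    by have [-> // | /negPf ts] := eqVneq t s; rewrite -Ps; congr (_ \in P _);
       case: (t) (s) ts => [] [].
  have [|[X XC [eX XP]]|[D cD [eD DP]]] := @matroid_painting e (P s :\ e).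
  - by rewrite in_setD1 eqxx.
  - left; have [Y YC [YX eY]] := circuit_orient s XC eX.
    exists Y => //; split=> // t f fe /side_supp; rewrite YX => /(subsetP XP).
    by rewrite in_setU1 in_setD1 (negPf fe) /= PE.
  right; have [U0 UD U0o] := cocircuit_signature cD.
  have cU0 : U0 \in cocircuits M by apply/cocircuitsP; rewrite UD.
  have [U cU [eU UD']] : exists2 U, U \in cocircuits M & e \in side s U /\ supp
    U = D.
    move: eD; rewrite -UD (in_supp s) => /orP[eU|eU]; first by exists U0.
    by exists (opp U0); rewrite ?cocircuit_opp // side_opp supp_opp.
  exists U => //; split=> // t f fe /side_supp; rewrite UD' => /(subsetP DP).
  by rewrite in_setC in_setD1 fe /= PE.
rewrite inE /= in ge.
have [t gt gNt] : exists2 t, g \in P t & g \notin P (~~ t).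
  by case: (boolP (g \in P s)) (gP) => gs gN; [exists s | exists (~~ s)];
    rewrite ?negbK //;
    move: gN; case: (g \in P (~~ s)).
pose Pdel r := P r :\ g; pose Pcon r := g |: P r.
have ltP (Q : bool -> {set E}) :
    (forall r f, f != g -> (f \in Q r) = (f \in P r)) ->
    (forall r, (g \in Q r) = (g \in Q s)) ->
    #|[set f | (f != e) && ((f \in Q (~~ s)) (+) (f \in Q s))]| < n.
  move=> QP Qg; apply: leq_trans leP; apply: proper_card; apply/properP; split.
    apply/subsetP => f; rewrite !inE => /andP[-> ].
    by have [-> | fg] := eqVneq f g; [rewrite Qg addbb | rewrite !QP].
  by exists g; rewrite !inE ?ge // Qg addbb andbF.
have [|[X XC [eX XP]]|[U cU [eU UP]]] := IHn Pdel.
- by apply: (ltP Pdel) => [r f fg|r]; rewrite !in_setD1 ?fg // eqxx.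
- left; exists X => //; split=> // r f fe /(XP _ _ fe).
  by rewrite in_setD1 => /andP[].
have [|[X XC [eX XP]]|[V cV [eV VP]]] := IHn Pcon; last first.
- right; exists V => //; split=> // r f fe /(VP _ _ fe).
  by rewrite in_setU1 negb_or => /andP[].
- have /cocircuitsP[_ /(_ X XC)/orthogonalP[orth _]] := cU.
  have [|r [f [fX fU]]] := orth; first by exists s, e.
  have fe : f != e.
    apply: contraTneq fU => fE; rewrite fE in fX *; rewrite (side_inj fX eX).
    exact: sideN.
  have fg : f = g.
    apply/eqP; apply: contraT => fg; have := UP _ _ fe fU.
    by rewrite negbK in_setD1 fg /=; have := XP _ _ fe fX;
      rewrite in_setU1 (negPf fg) /= => ->.
  rewrite {f}fg in fX fU fe *; have [rt | /negPf rt] := eqVneq r t.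
    left; exists X => //; split=> // r' f' f'e f'X.
    have := XP _ _ f'e f'X; rewrite in_setU1; have [f'g _ | //] := eqVneq f' g.
    by rewrite f'g in f'X *; rewrite (side_inj f'X fX) rt.
  have rt' : ~~ r = t by case: (r) (t) rt => [] [].
  right; exists U => //; split=> // r' f' f'e f'U.
  have := UP _ _ f'e f'U; rewrite in_setD1; have [f'g _ | //] := eqVneq f' g.
  by rewrite f'g in f'U *; rewrite (side_inj f'U fU) rt'.
by apply: (ltP Pcon) => [r f fg|r]; rewrite !in_setU1 ?(negPf fg) // eqxx.
Qed.

(** Otherwise painting gives a cocircuit U through f that agrees with X at f and
    can disagree with X only at e.  Then U has the sign of Y at e, and cannot
    disagree with Y anywhere, against orthogonality. *)
Lemma strong_elimination X Y r s e f : X \in C -> Y \in C ->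
  e \in side s X -> e \in side (~~ s) Y ->
  f \in side r X -> f \notin side (~~ r) Y ->
  exists2 Z, Z \in C & [/\ f \in side r Z, e \notin supp Z &
    forall t g, g \in side t Z -> (g \in side t X) || (g \in side t Y)].
Proof.
move=> XC YC eX eY fX fY.
have ef : f != e.
  by apply/eqP => fe; move: fX fY; rewrite fe => fX;
    rewrite (side_inj fX eX) eY.
have [[Z ZC [fZ ZP]]|[U cU [fU UP]]] :=
  painting (fun t => (side t X :|: side t Y) :\ e) f r.
  have Zin t g : g \in side t Z ->
      g = f /\ t = r \/ g \in (side t X :|: side t Y) :\ e.
    have [-> gZ | gf /(ZP _ _ gf)] := eqVneq g f; last by right.
    by left; rewrite (side_inj gZ fZ).
  exists Z => //; split=> // [|t g /Zin[[-> ->]|]].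
  - by apply/negP => /suppP[t /Zin[[/eqP]|]];
    rewrite ?in_setD1 ?eqxx // eq_sym (negPf ef).
  - by rewrite fX.
  by rewrite in_setD1 in_setU => /andP[].
have /cocircuitsP[_ orth] := cU.
have conflict t g : g != f -> g != e -> g \in side (~~ t) U ->
    (g \notin side t X) && (g \notin side t Y).
  move=> gf ge /(UP _ _ gf); rewrite negbK in_setD1 ge in_setU negb_or //.
have /orthogonalP[/(_ _)[] ] := orth X XC; first by exists r, f.
move=> t [g [gX gU]] _.
have gf : g != f by apply: contraTneq gU => gE; rewrite gE in gX *;
  rewrite (side_inj gX fX) sideN.
have ge : g = e.
  by apply/eqP; apply: contraT => ge; have := conflict t g gf ge gU; rewrite gX.
rewrite {}ge in gX gU gf; rewrite (side_inj gX eX) in gU.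
have /orthogonalP[/(_ _)[] ] := orth Y YC; first by exists (~~ s), e.
move=> t' [h [hY hU]] _; have [hf | hf] := eqVneq h f.
  rewrite hf in hY hU; have /eqP := side_inj hU fU;
    rewrite eqb_negLR => /eqP tr.
  by rewrite -tr hY in fY.
have [he | he] := eqVneq h e; last by have := conflict t' h hf he hU;
  rewrite hY andbF.
rewrite he in hY hU; rewrite (side_inj hY eY) in hU.
by have := sideN gU; rewrite hU.
Qed.

(** * Counting ranks along a linear order *)

(** Add the elements of D to A in increasing order for le: the rank grows at e
    unless a circuit through e lies in what has been added so far. *)
Lemma rk_count (le : rel E) A D : total le -> transitive le ->
  antisymmetric le -> [disjoint A & D] ->
  rk M (A :|: D) = rk M A + #|[set e in D | ~~ [exists X in C, (e \in supp X) &&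
    (supp X \subset A :|: [set f in D | le f e])]]|.
Proof.
move=> tot trans anti; have [n] := ubnP #|D|; elim: n D => // n IHn D ltD dAD.
have [-> | [m0 m0D]] := set_0Vmem D.
  rewrite setU0 (_ : [set e in set0 | _] = set0) ?cards0 ?addn0 //.
  by apply/setP => e; rewrite !inE.
pose ge x y := le y x.
have [m mD mmax] : exists2 m, m \in D & forall f, f \in D -> le f m.
  have refl : reflexive ge by move=> x; have := tot x x; rewrite orbb.
  have gtrans : transitive ge by move=> y x z xy yz; apply: trans yz xy.
  have gtot : total ge by move=> x y; apply: tot.
  by case: (@extremumP _ _ ge m0 [in D] id refl gtrans gtot m0D) => m; exists m.
have DE : A :|: D = m |: (A :|: D :\ m) by rewrite setUCA setD1K.
have mA : m \notin A by have := disjointFl dAD mD => ->.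
rewrite DE rkU1; last by rewrite !inE eqxx (negPf mA).
rewrite IHn; first last.
- by apply: disjointWr dAD; apply: subsetDl.
- by move: ltD; rewrite (cardsD1 m) mD add1n ltnS.
rewrite -addnA [in RHS](cardsD1 m); congr (_ + _).
rewrite [LHS]addnC; congr (_ + _).
  rewrite inE mD /=; congr (nat_of_bool (~~ _)); apply: eq_existsb => X.
  rewrite -DE; do 2!congr (_ && _); congr (_ \subset _ :|: _).
  by apply/setP => f; rewrite inE; case: (boolP (f \in D)) => //= /mmax ->.
apply: eq_card => e; rewrite !inE; case: eqVneq => //= em.
case: (boolP (e \in D)) => //= eD; congr (~~ _); apply: eq_existsb => X.
do 2!congr (_ && _); congr (_ \subset _ :|: _).
apply/setP => f; rewrite !inE; case: eqVneq => //= fm.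
rewrite fm mD /=; apply/esym/negbTE; apply: contraNN em => me.
by apply/eqP/anti; rewrite me mmax.
Qed.

End Painting.

(** * Sign patterns and the effect of one element *)

Section Patterns.
Context (d : Order.disp_t) (E : finOrderType d).
Implicit Types (M : orientedMatroid E) (X Y Z : sset E) (P : bool -> E -> bool).
Implicit Types (e f g w : E) (s t r : bool) (c : bool -> bool) (A T : {set E}).

Lemma smallestP (S : {set E}) e :
  reflect (e \in S /\ forall f, f \in S -> (e <= f)%O) (smallest S e).
Proof. by apply: (iffP andP) => -[eS /forall_inP]. Qed.

(** In the minor described by a pattern P: e is the least element of a positive
    circuit.  Contracted elements count as part of the circuit here, which is
    harmless as long as they lie above all the others. *)
Definition starts M P e := [exists X in circuits M, (e \in supp X) &&
  [forall s, forall f, (f \in side s X) ==> (e <= f)%O && P s f]].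

(** By painting, this circuit is what prevents e from being the least element of
    a positive cocircuit: it is unconstrained below e, where that cocircuit
    vanishes. *)
Definition blocks M P e r := [exists X in circuits M, (e \in side r X) &&
  [forall s, forall f, (f \in side s X) && (e < f)%O ==> P s f]].

Lemma startsP M P e : reflect (exists2 X, X \in circuits M & e \in supp X /\
    forall s f, f \in side s X -> (e <= f)%O /\ P s f) (starts M P e).
Proof.
apply: (iffP exists_inP) => -[X XC].
  case/andP=> eX /forallP allX; exists X => //; split=> // s f fX.
  by have /forallP/(_ f)/implyP/(_ fX)/andP := allX s.
case=> eX allX; exists X => //; rewrite eX; apply/forallP => s;
  apply/forallP => f.
by apply/implyP => /allX[-> ->].
Qed.

Lemma blocksP M P e r : reflect (exists2 X, X \in circuits M & e \in side r X /\
    forall s f, f \in side s X -> (e < f)%O -> P s f) (blocks M P e r).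
Proof.
apply: (iffP exists_inP) => -[X XC].
  case/andP=> eX /forallP allX; exists X => //; split=> // s f fX ef.
  by have /forallP/(_ f)/implyP := allX s; rewrite fX ef; apply.
case=> eX allX; exists X => //; rewrite eX; apply/forallP => s;
  apply/forallP => f.
by apply/implyP => /andP[]; apply: allX.
Qed.

Definition update P w c s f := if f == w then c s else P s f.

Lemma perspective_circuit M M' X w s : perspective M M' -> X \in circuits M ->
  w \in side s X -> exists2 Y, Y \in circuits M' & w \in side s Y /\
    forall t f, f \in side t Y -> f \in side t X.
Proof.
move=> hMM' /hMM'[F [FC Xp Xn]] wX.
have XE t : side t X = \bigcup_(Y in F) side t Y by case: t.
move: wX; rewrite XE => /bigcupP[Y YF wY]; exists Y; first exact: (subsetP FC).
by split=> // t f fY; rewrite XE; apply/bigcupP; exists Y.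
Qed.

(** The elements below w are the reoriented ones, with prescribed sign sigma;
    those above w are deleted or contracted.  The pattern at w varies. *)
Section Toggle.
Context (M M' : orientedMatroid E) (hMM' : perspective M M').
Context (P : bool -> E -> bool) (w : E) (sigma : E -> bool).
Hypothesis below : forall f s, (f < w)%O -> P s f = (s == sigma f).
Hypothesis above : forall f s, (w < f)%O -> P s f = P (~~ s) f.

Local Notation none := (fun=> false).
Local Notation any := (fun=> true).
Local Notation only s := (fun t : bool => t == s).
Local Notation O c := (starts M (update P w c)).
Local Notation N c e := (blocks M' (update P w c) e (sigma e)).

Lemma starts_mono c c' e : (forall s, c s -> c' s) -> O c e -> O c' e.
Proof.
move=> cc' /startsP[X XC [eX allX]]; apply/startsP; exists X => //;
  split=> // s f fX.
have [-> ] := allX s f fX; rewrite /update; case: eqP => // _ /cc' //.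
Qed.

Lemma blocks_mono c c' e : (forall s, c s -> c' s) -> N c e -> N c' e.
Proof.
move=> cc' /blocksP[X XC [eX allX]]; apply/blocksP; exists X => //;
  split=> // s f fX ef.
by have := allX s f fX ef; rewrite /update; case: eqP => // _ /cc'.
Qed.

Lemma starts_through c e : O c e -> ~~ O none e -> exists s,
  exists2 X, X \in circuits M & [/\ w \in side s X, c s, e \in supp X,
    (e <= w)%O &
    forall t f, f \in side t X -> f != w -> (e <= f)%O /\ P t f].
Proof.
move=> /startsP[X XC [eX allX]] nO.
have [wX | wX] := boolP (w \in supp X); last first.
  case/negP: nO; apply/startsP; exists X => //; split=> // s f fX.
  have [ef] := allX s f fX; rewrite /update; case: eqVneq => // fw.
  by rewrite -fw (side_supp fX) in wX.
have [s ws] := suppP wX; exists s, X => //; have [ew] := allX s w ws.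
rewrite /update eqxx => cs; split=> // t f fX fw.
by have := allX t f fX; rewrite /update (negPf fw).
Qed.

Lemma blocks_through c e : N c e -> ~~ N none e -> exists s,
  exists2 X, X \in circuits M' & [/\ w \in side s X, c s,
    e \in side (sigma e) X, (e < w)%O &
    forall t f, f \in side t X -> f != w -> (e < f)%O -> P t f].
Proof.
move=> /blocksP[X XC [eX allX]] nN.
have [/andP[wX ew] | wX] := boolP ((w \in supp X) && (e < w)%O); last first.
  case/negP: nN; apply/blocksP; exists X => //; split=> // s f fX ef.
  have := allX s f fX ef; rewrite /update; case: eqVneq => // fw.
  by rewrite -fw (side_supp fX) ef in wX.
have [s ws] := suppP wX; exists s, X => //; have := allX s w ws ew.
rewrite /update eqxx => cs; split=> // t f fX fw ef.
by have := allX t f fX ef; rewrite /update (negPf fw).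
Qed.

Lemma starts_none Z e : Z \in circuits M -> e \in supp Z -> w \notin supp Z ->
  (forall t f, f \in side t Z -> f != w -> (e <= f)%O /\ P t f) -> O none e.
Proof.
move=> ZC eZ wZ allZ; apply/startsP; exists Z => //; split=> // t f fZ.
have fw : f != w by apply: contraNneq wZ => <-; apply: side_supp fZ.
by rewrite /update (negPf fw); apply: allZ.
Qed.

Lemma blocks_none Z e : Z \in circuits M' -> e \in side (sigma e) Z ->
  w \notin supp Z ->
  (forall t f, f \in side t Z -> f != w -> (e < f)%O -> P t f) -> N none e.
Proof.
move=> ZC eZ wZ allZ; apply/blocksP; exists Z => //; split=> // t f fZ ef.
have fw : f != w by apply: contraNneq wZ => <-; apply: side_supp fZ.
by rewrite /update (negPf fw); apply: allZ.
Qed.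

(** A circuit has at most one sign at w. *)
Lemma starts_any e : O any e -> exists s, O (only s) e.
Proof.
have [Oe | nO] := boolP (O none e); first by exists true; apply: starts_mono Oe.
case/starts_through=> // s [X XC [wX _ eX ew allX]]; exists s; apply/startsP.
exists X => //; split=> // t f fX; rewrite /update; case: eqVneq => [fw | fw].
  by rewrite fw in fX *; rewrite (side_inj fX wX).
exact: allX.
Qed.

Lemma blocks_any e : N any e -> exists s, N (only s) e.
Proof.
have [Ne | nN] := boolP (N none e); first by exists true; apply: blocks_mono Ne.
case/blocks_through=> // s [X XC [wX _ eX ew allX]]; exists s; apply/blocksP.
exists X => //; split=> // t f fX ef; rewrite /update;
  case: eqVneq => [fw | fw].
  by rewrite fw in fX; rewrite (side_inj fX wX).
exact: allX fw ef.
Qed.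

(** If both signs at w gave new activities, eliminating w between the two
    circuits while keeping the smaller of e and f would make this element active
    without the help of w. *)
Lemma starts_starts s e f : e != w -> f != w -> O (only s) e -> ~~ O none e ->
  O (only (~~ s)) f -> ~~ O none f -> False.
Proof.
wlog ef : s e f / (e <= f)%O => [wl ew fw Oe nOe Of nOf | ew fw Oe nOe Of nOf].
  have /orP[ef | fe] := le_total e f; first exact: (wl s e f).
  by apply: (wl (~~ s) f e) => //; rewrite negbK.
have [s1 [X XC [wX /eqP s1E eX ltew allX]]] := starts_through Oe nOe.
have [s2 [Y YC [wY /eqP s2E fY _ allY]]] := starts_through Of nOf.
rewrite {}s1E {}s2E in wX wY; have [r erX] := suppP eX.
have {}ltew : (e < w)%O by rewrite lt_neqAle ew.
have erY : e \notin side (~~ r) Y.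
  apply/negP => eY; have [_] := allY _ _ eY ew; have [_] := allX _ _ erX ew.
  by rewrite !below //; case: (r) (sigma e) => [] [].
have [Z ZC [eZ wZ ZXY]] := strong_elimination XC YC wX wY erX erY.
case/negP: nOe; apply: (starts_none ZC (side_supp eZ) wZ) => t g gZ gw.
case/orP: (ZXY _ _ gZ) => [gX | gY]; first exact: allX.
by have [fg ->] := allY _ _ gY gw; rewrite (le_trans ef fg).
Qed.

(** Here the larger of e and f is kept: the other circuit is constrained above
    the smaller one, hence at and above the larger one. *)
Lemma blocks_blocks s e f : N (only s) e -> ~~ N none e ->
  N (only (~~ s)) f -> ~~ N none f -> False.
Proof.
wlog ef : s e f / (e <= f)%O => [wl Ne nNe Nf nNf | Ne nNe Nf nNf].
  have /orP[ef | fe] := le_total e f; first exact: (wl s e f).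
  by apply: (wl (~~ s) f e) => //; rewrite negbK.
have [s1 [X XC [wX /eqP s1E eX _ allX]]] := blocks_through Ne nNe.
have [s2 [Y YC [wY /eqP s2E fY ltfw allY]]] := blocks_through Nf nNf.
rewrite {}s1E {}s2E in wX wY.
have fX : f \notin side (~~ sigma f) X.
  apply/negP => fX; move: ef; rewrite le_eqVlt => /orP[/eqP ef | ef].
    by rewrite ef in eX; have := sideN eX; rewrite fX.
  by have := allX _ _ fX (negbT (lt_eqF ltfw)) ef; rewrite below //;
    case: (sigma f).
have wX' : w \in side (~~ ~~ s) X by rewrite negbK.
have [Z ZC [fZ wZ ZXY]] := strong_elimination YC XC wY wX' fY fX.
case/negP: nNf; apply: (blocks_none ZC fZ wZ) => t g gZ gw fg.
case/orP: (ZXY _ _ gZ) => [gY | gX]; first exact: allY.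
by apply: allX => //; apply: le_lt_trans ef fg.
Qed.

(** The circuit of M through w contains a circuit of M' through w with the same
    signs, and w can be eliminated in M'. *)
Lemma starts_blocks s e g : O (only s) e -> ~~ O none e ->
  N (only (~~ s)) g -> ~~ N none g -> False.
Proof.
move=> Oe nOe Ng nNg.
have [s1 [X0 X0C [wX0 /eqP s1E _ _ allX]]] := starts_through Oe nOe.
have [s2 [Y YC [wY /eqP s2E gY ltgw allY]]] := blocks_through Ng nNg.
rewrite {}s1E {}s2E in wX0 wY.
have [X XC [wX XX0]] := perspective_circuit hMM' X0C wX0.
have gX : g \notin side (~~ sigma g) X.
  apply/negP => /XX0/allX/(_ (negbT (lt_eqF ltgw)))[_].
  by rewrite below //; case: (sigma g).
have wX' : w \in side (~~ ~~ s) X by rewrite negbK.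
have [Z ZC [gZ wZ ZXY]] := strong_elimination YC XC wY wX' gY gX.
case/negP: nNg; apply: (blocks_none ZC gZ wZ) => t f fZ fw gf.
case/orP: (ZXY _ _ fZ) => [fY | /XX0 fX]; first exact: allY.
by have [] := allX _ _ fX fw.
Qed.

(** Above w the pattern is symmetric, so the sign at w can be chosen freely. *)
Lemma flip_circuit M0 X s : X \in circuits M0 -> w \in supp X ->
  (forall t f, f \in side t X -> f != w -> (w < f)%O -> P t f) ->
  exists2 Y, Y \in circuits M0 & [/\ w \in side s Y, supp Y = supp X &
    forall t f, f \in side t Y -> f != w -> (w < f)%O -> P t f].
Proof.
move=> XC; rewrite (in_supp s) => /orP[wX|wX] allX; first by exists X.
exists (opp X); first exact: circuit_opp.
rewrite side_opp supp_opp; split=> // t f; rewrite side_opp => fX fw wf.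
by rewrite above //; apply: allX.
Qed.

(** [starts M (update P w any) w] says that w is a loop of the minor of M,
    and [~~ blocks M' (update P w any) w (sigma w)] that it is an isthmus of the
    minor of M'. *)
Lemma starts_loop c s : c s -> O c w = O any w.
Proof.
move=> cs; apply/idP/idP; first exact: starts_mono.
case/startsP=> X XC [wX allX]; have [|Y YC [wY YX allY]] :=
  flip_circuit s XC wX.
  by move=> t f fX fw wf; have [_] := allX _ _ fX; rewrite /update (negPf fw).
apply/startsP; exists Y => //; split=> [|t f fY]; first exact: side_supp wY.
have [t' fX] : exists t', f \in side t' X by apply/suppP;
  rewrite -YX (side_supp fY).
have [wf _] := allX _ _ fX; split=> //; rewrite /update;
  case: eqVneq => [fw | fw].
  by rewrite fw in fY; rewrite (side_inj fY wY).
by apply: allY => //; rewrite lt_neqAle eq_sym fw.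
Qed.

Lemma starts_none_last : ~~ O none w.
Proof.
apply/startsP => -[X XC [/suppP[s wX] allX]].
by have [_] := allX _ _ wX; rewrite /update eqxx.
Qed.

Lemma blocks_last c s : blocks M' (update P w c) w s = N any w.
Proof.
apply/blocksP/blocksP => -[X XC [wX allX]].
  have [|Y YC [wY _ allY]] := flip_circuit (sigma w) XC (side_supp wX).
    by move=> t f fX fw wf; have := allX _ _ fX wf; rewrite /update (negPf fw).
  exists Y => //; split=> // t f fY wf; rewrite /update; case: eqVneq => // fw.
  exact: allY.
have [|Y YC [wY _ allY]] := flip_circuit s XC (side_supp wX).
  by move=> t f fX fw wf; have := allX _ _ fX wf; rewrite /update (negPf fw).
exists Y => //; split=> // t f fY wf; rewrite /update; case: eqVneq => [fw|fw].
  by rewrite fw ltxx in wf.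
exact: allY.
Qed.

Lemma loop_blocks : O any w -> N any w.
Proof.
case/startsP=> X0 X0C [/suppP[s wX0] allX].
have [X XC [wX XX0]] := perspective_circuit hMM' X0C wX0.
rewrite -(blocks_last any s); apply/blocksP; exists X => //;
  split=> // t f /XX0 fX _.
by have [] := allX _ _ fX.
Qed.

(** A circuit inside w and the contracted elements removes w from any other
    circuit without touching the elements below w. *)
Lemma loop_starts e : O any w -> e != w -> O any e -> O none e.
Proof.
move=> /startsP[X XC [wX allX]] ew Oe; apply: contraT => nOe.
have [s [Y YC [wY _ eY leew allY]]] := starts_through Oe nOe.
have [|X' X'C [wX' X'X allX']] := flip_circuit (~~ s) XC wX.
  by move=> t f fX fw wf; have [_] := allX _ _ fX; rewrite /update (negPf fw).
have [r erY] := suppP eY; have ltew : (e < w)%O by rewrite lt_neqAle ew.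
have above_w f : f \in supp X' -> (w <= f)%O.
  by rewrite X'X => /suppP[t fX]; have [] := allX _ _ fX.
have eX' : e \notin side (~~ r) X'.
  by apply/negP => /side_supp/above_w; rewrite leNgt ltew.
have [Z ZC [eZ wZ ZXY]] := strong_elimination YC X'C wY wX' erY eX'.
case/negP: nOe; apply: (starts_none ZC (side_supp eZ) wZ) => t f fZ fw.
case/orP: (ZXY _ _ fZ) => [fY|fX']; first exact: allY.
have wf := above_w f (side_supp fX'); rewrite (le_trans leew wf); split=> //.
by apply: allX' => //; rewrite lt_neqAle eq_sym fw.
Qed.

Lemma loop_blocks_none e : O any w -> N any e -> N none e.
Proof.
move=> /startsP[X0 X0C [wX0 allX]] Ne; apply: contraT => nNe.
have [s [Y YC [wY _ eY ltew allY]]] := blocks_through Ne nNe.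
have [|X' X'C [wX' X'X allX']] := flip_circuit (~~ s) X0C wX0.
  by move=> t f fX fw wf; have [_] := allX _ _ fX; rewrite /update (negPf fw).
have [X XC [wX XX']] := perspective_circuit hMM' X'C wX'.
have above_w f t : f \in side t X -> (w <= f)%O.
  by move/XX'/side_supp; rewrite X'X => /suppP[t' fX]; have [] := allX _ _ fX.
have eX : e \notin side (~~ sigma e) X.
  by apply/negP => /above_w; rewrite leNgt ltew.
have [Z ZC [eZ wZ ZXY]] := strong_elimination YC XC wY wX eY eX.
case/negP: nNe; apply: (blocks_none ZC eZ wZ) => t f fZ fw ef.
case/orP: (ZXY _ _ fZ) => [fY|fX]; first exact: allY.
by apply: allX'; rewrite ?XX' // lt_neqAle eq_sym fw (above_w f t).
Qed.

Lemma isthmus_starts e : ~~ N any w -> O any e -> O none e.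
Proof.
move=> nNw Oe; apply: contraT => nOe.
have [s [Y0 Y0C [wY0 _ _ _ allY]]] := starts_through Oe nOe.
have [Y YC [wY YY0]] := perspective_circuit hMM' Y0C wY0.
case/negP: nNw; rewrite -(blocks_last any s); apply/blocksP; exists Y => //.
split=> // t f /YY0 fY wf; rewrite /update; case: eqVneq => // fw.
by have [] := allY _ _ fY fw.
Qed.

Lemma isthmus_blocks e : ~~ N any w -> N any e -> N none e.
Proof.
move=> nNw Ne; apply: contraT => nNe.
have [s [Y YC [wY _ _ ltew allY]]] := blocks_through Ne nNe.
case/negP: nNw; rewrite -(blocks_last any s); apply/blocksP; exists Y => //.
split=> // t f fY wf; rewrite /update; case: eqVneq => // fw.
by apply: allY => //; apply: lt_trans ltew wf.
Qed.

Lemma squeeze (Q : (bool -> bool) -> bool) c :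
  (forall c1 c2, (forall s, c1 s -> c2 s) -> Q c1 -> Q c2) ->
  (Q any -> Q none) -> Q c = Q none.
Proof.
move=> mono anynone; apply/idP/idP => [Qc|]; last exact: mono.
by apply: anynone; apply: mono Qc.
Qed.

Definition same_off_w c c' :=
  forall e, e != w -> O c e = O c' e /\ N c e = N c' e.

Lemma toggle_degenerate c : O any w || ~~ N any w -> same_off_w c none.
Proof.
move=> deg e ew; split.
  apply: (squeeze (Q := fun c => O c e)) => [c1 c2|]; first exact: starts_mono.
  by case/orP: deg => [loop|isth]; [apply: loop_starts | apply: isthmus_starts].
apply: (squeeze (Q := fun c => N c e)) => [c1 c2|]; first exact: blocks_mono.
by case/orP: deg => [loop|isth];
  [apply: loop_blocks_none | apply: isthmus_blocks].
Qed.

(** At most one of the two signs at w can give anything beyond the pattern none;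
    let s be the other one.  Whatever the pattern any gives comes from one of
    the signs, hence from none or from [~~ s]. *)
Lemma toggle :
  exists s, same_off_w (only s) none /\ same_off_w (only (~~ s)) any.
Proof.
pose moves s := [exists e, (e != w) &&
  (O (only s) e && ~~ O none e || N (only s) e && ~~ N none e)].
have [s still] : exists s, ~~ moves s.
  have [/existsP[e /andP[ew moved]]|] := boolP (moves true);
    last by exists true.
  exists false; apply/existsP => -[f /andP[fw]].
  case/orP: moved => /andP[] => [Oe nOe|Ne nNe] /orP[]/andP[moved_f still_f].
  - exact: (@starts_starts true e f).
  - exact: (@starts_blocks true e f).
  - exact: (@starts_blocks false f e).
  - exact: (@blocks_blocks true e f).
have stay e : e != w ->
    (O (only s) e -> O none e) /\ (N (only s) e -> N none e).
  move=> ew; split=> [Oe|Ne]; apply: contraT => nH; case/negP: still;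
    apply/existsP; exists e; rewrite ew.
    by rewrite Oe nH.
  by rewrite Ne nH orbT.
exists s; split=> e ew; have [Os Ns] := stay e ew.
  by split; apply/idP/idP => //; [apply: starts_mono | apply: blocks_mono].
have other s' : s' = s \/ s' = ~~ s by case: (s) (s') => [] []; auto.
split; apply/idP/idP; [exact: starts_mono | | exact: blocks_mono |].
  case/starts_any=> s' ; case: (other s') => -> // /Os; exact: starts_mono.
case/blocks_any=> s' ; case: (other s') => -> // /Ns; exact: blocks_mono.
Qed.

End Toggle.
End Patterns.

Local Open Scope ring_scope.

(** * The telescoping sum *)

Section Weights.
Context (d : Order.disp_t) (E : finOrderType d) (M M' : orientedMatroid E).
Context (R : comNzRingType) (x u y v : R).
Implicit Types (A T : {set E}) (e f w : E) (s t a b o : bool).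

(** Outside T, the elements of A are reoriented; inside T, the elements of A are
    contracted and the others deleted. *)
Definition pattern T A s f := if f \in T then f \in A else s == (f \notin A).

(** For e in T, a loop of the minor of M can only be a contracted element, and
    an isthmus of the minor of M' is counted only when it is deleted; so every
    element contributes as in the deletion/contraction recursion of the Tutte
    polynomial. *)
Definition dual_weight t a b : R :=
  if b then 1
  else if t then (if a then 1 else x + u - 1) else if a then u else x.

Definition primal_weight t a o : R :=
  if o then (if t then y + v - 1 else if a then v else y) else 1.

Definition weight T A e :=
  dual_weight (e \in T) (e \in A) (blocks M' (pattern T A) e (e \notin A)) *
  primal_weight (e \in T) (e \in A) (starts M (pattern T A) e).

Definition hybrid T := \sum_A \prod_e weight T A e.

Lemma starts_ext (N : orientedMatroid E) P Q e : (forall s f, P s f = Q s f) ->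
  starts N P e = starts N Q e.
Proof.
move=> PQ; apply/startsP/startsP => -[X XC [eX allX]];
  by exists X => //; split=> // s f /allX; rewrite PQ.
Qed.

Lemma blocks_ext (N : orientedMatroid E) P Q e s :
  (forall s f, P s f = Q s f) ->
  blocks N P e s = blocks N Q e s.
Proof.
move=> PQ; apply/blocksP/blocksP => -[X XC [eX allX]];
  by exists X => //; split=> // t f fX /(allX _ _ fX); rewrite PQ.
Qed.

Lemma big_set_pairs w (F : {set E} -> R) :
  \sum_A F A = \sum_(A : {set E} | w \notin A) (F A + F (w |: A)).
Proof.
rewrite (bigID (fun A : {set E} => w \notin A)) /= big_split /=; congr (_ + _).
rewrite (reindex_onto (fun A : {set E} => w |: A) (fun A => A :\ w)) /=;
  last first.
  by move=> A; rewrite negbK => /setD1K.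
apply: eq_bigl => A; rewrite setU11 /=; apply/eqP/idP => [<-|wA].
  by rewrite in_setD1 eqxx.
exact: setU1K.
Qed.

(** The four products for T or w |: T and for A or w |: A differ only through
    the pattern at w, which is +, - (for T), none, any (for w |: T).  Either w
    is a loop or an isthmus and the four products over the other elements
    coincide, or w contributes 1 to each of them and [toggle] matches them in
    pairs. *)
Lemma hybrid_step T w : perspective M M' ->
  (forall f g, f \in T -> g \notin T -> (g < f)%O) ->
  w \notin T -> (forall f, f \notin T -> (f <= w)%O) ->
  hybrid T = hybrid (w |: T).
Proof.
move=> hMM' upT wT maxw; rewrite /hybrid !(big_set_pairs w);
  apply: eq_bigr => A wA.
set P := pattern T A; pose sigma f := f \notin A.
have below f s : (f < w)%O -> P s f = (s == sigma f).
  move=> fw; rewrite /P /pattern; case: ifP => // /upT/(_ wT)/(lt_trans fw).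
  by rewrite ltxx.
have above f s : (w < f)%O -> P s f = P (~~ s) f.
  move=> wf; rewrite /P /pattern; case: ifPn => // /maxw; rewrite leNgt wf //.
pose only s := fun t : bool => t == s.
pose G c := \prod_(e | e != w) (dual_weight (e \in T) (e \in A)
  (blocks M' (update P w c) e (sigma e)) * primal_weight (e \in T) (e \in A)
  (starts M (update P w c) e)).
have termE T1 A1 c : (forall s f, pattern T1 A1 s f = update P w c s f) ->
    (forall e, e != w -> (e \in T1) = (e \in T)) ->
    (forall e, e != w -> (e \in A1) = (e \in A)) ->
    \prod_e weight T1 A1 e = weight T1 A1 w * G c.
  move=> PE T1E A1E; rewrite (bigD1 w) //=; congr (_ * _);
    apply: eq_bigr => e ew.
  by rewrite /weight T1E // A1E // (starts_ext _ _ PE) (blocks_ext _ _ _ PE).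
pose L := starts M (update P w (fun=> true)) w.
pose K := blocks M' (update P w (fun=> true)) w (sigma w).
have weightE T1 A1 c s0 : (forall s f, pattern T1 A1 s f = update P w c s f) ->
    c s0 -> weight T1 A1 w = dual_weight (w \in T1) (w \in A1) K *
      primal_weight (w \in T1) (w \in A1) L.
  move=> PE cs; rewrite /weight (blocks_ext _ _ _ PE) (starts_ext _ _ PE).
  by rewrite (blocks_last M' sigma above) (starts_loop M above cs).
have in_wU S e : e != w -> (e \in w |: S) = (e \in S).
  by move=> ew; rewrite in_setU1 (negPf ew).
have pat_pos s f : pattern T A s f = update P w (only true) s f.
  by rewrite /update; case: eqP => // ->; rewrite /pattern (negPf wT) wA.
have pat_neg s f : pattern T (w |: A) s f = update P w (only false) s f.
  rewrite /update; case: eqVneq => [-> | fw];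
    rewrite /pattern ?(negPf wT) ?setU11 //.
  by rewrite /P /pattern in_wU.
have pat_del s f : pattern (w |: T) A s f = update P w (fun=> false) s f.
  rewrite /update; case: eqVneq => [-> | fw];
    rewrite /pattern ?setU11 ?(negPf wA) //.
  by rewrite /P /pattern in_wU.
have pat_con s f : pattern (w |: T) (w |: A) s f = update P w (fun=> true) s f.
  rewrite /update; case: eqVneq => [-> | fw]; rewrite /pattern ?setU11 //.
  by rewrite /P /pattern !in_wU.
rewrite (termE _ _ _ pat_pos) // (termE _ _ _ pat_neg) ?(termE _ _ _ pat_del)
  ?(termE _ _ _ pat_con) //;
  try exact: in_wU.
rewrite (weightE _ _ _ true pat_pos) // (weightE _ _ _ false pat_neg) //
  (weightE _ _ _ true pat_con) //.
have -> : weight (w |: T) A w = dual_weight true false K.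
  rewrite /weight (blocks_ext _ _ _ pat_del) (starts_ext _ _ pat_del) setU11
    (negPf wA).
  rewrite (blocks_last M' sigma above) (negPf (starts_none_last _ _ _)).
  by rewrite mulr1.
rewrite !setU11 (negPf wT) (negPf wA).
have G_same c c' : same_off_w M M' P w sigma c c' -> G c = G c'.
  by move=> cc'; apply: eq_bigr => e /cc'[-> ->].
have [deg | ] := boolP (L || ~~ K).
  have GE c : G c = G (fun=> false) by apply/G_same/toggle_degenerate.
  rewrite !GE; set g := G _.
  case: (boolP L) deg => [loop _ | _ /negPf->] /=.
    have -> : K by exact: loop_blocks loop.
    by rewrite /dual_weight /primal_weight; ring.
  by rewrite /dual_weight /primal_weight; ring.
rewrite negb_or negbK => /andP[/negPf-> ->];
  rewrite /dual_weight /primal_weight !mul1r.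
have [s [/G_same stay /G_same move_]] := toggle hMM' below.
by case: s stay move_ => <- <- //; rewrite addrC.
Qed.

Lemma hybrid_constant : perspective M M' -> hybrid set0 = hybrid setT.
Proof.
move=> hMM'; suff H n T : #|~: T| = n ->
    (forall f g, f \in T -> g \notin T -> (g < f)%O) -> hybrid T = hybrid setT.
  by apply: (H _ _ erefl) => f g; rewrite inE.
elim: n T => [|n IHn] T cT upT.
  by rewrite -[T]setCK (cards0_eq cT) setC0.
have [w0 w0T] : exists w0, w0 \in ~: T by apply/card_gt0P; rewrite cT.
have [w wT maxw] : exists2 w, w \in ~: T & forall f, f \in ~: T -> (f <= w)%O.
  by case: (arg_maxP id w0T) => w wT maxw; exists w.
rewrite inE in wT; rewrite (@hybrid_step T w) //; last first.
  by move=> f fT; apply: maxw; rewrite inE.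
apply: IHn => [|f g]; last first.
  rewrite !in_setU1 negb_or => /orP[/eqP -> | fT] /andP[gw gT]; last exact: upT.
  by rewrite lt_neqAle gw maxw // inE.
move: cT; rewrite (cardsD1 w) inE wT add1n => -[<-].
by apply: eq_card => f; rewrite !inE negb_or.
Qed.


(** * The two ends of the telescope *)

Lemma prod_two_colors (S A : {set E}) (a b : R) :
  \prod_e (if e \in S then if e \in A then b else a else 1) =
  a ^+ #|S :\: A| * b ^+ #|S :&: A|.
Proof.
rewrite -!prodr_const -big_mkcond /= (bigID [in A]) /= mulrC; congr (_ * _).
  rewrite (eq_bigl [in S :\: A]); last by move=> e; rewrite inE andbC.
  by apply: eq_bigr => e; rewrite inE => /andP[/negPf->].
rewrite (eq_bigl [in S :&: A]); last by move=> e; rewrite inE.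
by apply: eq_bigr => e; rewrite inE => /andP[_ ->].
Qed.

Lemma starts_set0 A e :
  starts M (pattern set0 A) e = (e \in Oact (reorient A M)).
Proof.
rewrite inE; apply/startsP/exists_inP => -[X XC].
  case=> eX allX; exists (reorient_sset A X).
    by rewrite in_reorient_circuits reorient_ssetK.
  apply/andP; split.
    apply/positiveP => s f; rewrite side_reorient => /allX[_].
    by rewrite /pattern inE; case: s; case: (f \in A).
  apply/smallestP; rewrite supp_reorient; split=> // f /suppP[s /allX[]] //.
rewrite in_reorient_circuits in XC.
case/andP=> /positiveP posX /smallestP[eX minX];
  exists (reorient_sset A X) => //.
rewrite supp_reorient; split=> // s f; rewrite side_reorient => fX.
rewrite minX ?(side_supp fX) // /pattern inE; split=> //.
by have := posX _ _ fX; case: s {fX}; case: (f \in A).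
Qed.

(** Painting, with both signs allowed below e and the prescribed one above. *)
Lemma blocks_set0 A e : ~~ blocks M' (pattern set0 A) e (e \notin A) =
  (e \in Oact_dual (reorient A M')).
Proof.
have patE s f : pattern set0 A s f = (s == (f \notin A)) by rewrite /pattern
  inE.
rewrite inE; apply/idP/exists_inP => [/blocksP nb | [U]].
  have [[X XC [eX XP]]|[U cU [eU UP]]] := @painting _ M'
     (fun s => [set f | (f < e)%O || (s == (f \notin A))]) e (e \notin A).
    case: nb; exists X => //; split=> // s f fX ef.
    have := XP _ _ _ fX; rewrite (gt_eqF ef) => /(_ isT).
    by rewrite inE patE lt_gtF.
  have UE s f : f \in side s U -> (e <= f)%O /\ s = (f \notin A).
    have [-> fU | fe /(UP _ _ fe)] := eqVneq f e;
      first by rewrite (side_inj fU eU).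
    by rewrite inE negb_or -leNgt; case: (s); case: (f \in A);
      rewrite ?andbT ?andbF.
  exists (reorient_sset A U).
    by rewrite cocircuits_reorient in_reorient_circuits reorient_ssetK.
  apply/andP; split.
    apply/positiveP => s f; rewrite side_reorient => /UE[_].
    by case: s; case: (f \in A).
  apply/smallestP; rewrite supp_reorient (side_supp eU); split=> // f.
  by case/suppP=> s /UE[].
rewrite cocircuits_reorient in_reorient_circuits =>
  cU /andP[/positiveP posU /smallestP[eU minU]].
set V := reorient_sset A U in cU.
have VE s f : f \in side s V -> (e <= f)%O /\ s = (f \notin A).
  rewrite side_reorient => fU; rewrite minU ?(side_supp fU) //; split=> //.
  by have := posU _ _ fU; case: s {fU}; case: (f \in A).
have eV : e \in side (e \notin A) V.
  have := eU; rewrite -(supp_reorient A U) => /suppP[s eV].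
  by have [_ <-] := VE _ _ eV.
apply/blocksP => -[X XC [eX allX]];
  have /cocircuitsP[_ /(_ X XC)/orthogonalP[orth _]] := cU.
have [|s [f [fX fV]]] := orth; first by exists (e \notin A), e.
have [ef sE] := VE _ _ fV; have [fe | fe] := eqVneq f e.
  rewrite fe in fX sE; rewrite -sE in eX.
  by have := sideN fX; rewrite eX.
have := allX _ _ fX; rewrite lt_neqAle eq_sym fe ef patE -sE => /(_ isT).
by case: (s).
Qed.

Lemma hybrid_set0 : hybrid set0 = \sum_(A : {set E})
  x ^+ theta_dual M' A * u ^+ theta_bar_dual M' A *
  (y ^+ theta M A * v ^+ theta_bar M A).
Proof.
apply: eq_bigr => A _; rewrite /theta_dual /theta_bar_dual /theta /theta_bar.
rewrite -!prod_two_colors -big_split; apply: eq_bigr => e _ /=.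
by rewrite /weight inE -blocks_set0 -starts_set0; case: blocks.
Qed.

(** Build A from its greatest element downwards. *)
Lemma nullity_count A :
  (#|A| - rk M A)%N = #|[set e | starts M (pattern setT A) e]|.
Proof.
have d0A : [disjoint set0 & A] by rewrite disjoints_subset sub0set.
have := rk_count M (@ge_total _ E) ge_trans ge_anti d0A; rewrite set0U => ->.
have -> : rk M set0 = 0%N.
  by have [I [_]] := rk_witness M set0; rewrite subset0 => /eqP -> <-;
    rewrite cards0.
pose S := [set e | starts M (pattern setT A) e]; have SA : S \subset A.
  apply/subsetP => e; rewrite inE => /startsP[X XC [/suppP[s eX] allX]].
  by have [_] := allX _ _ eX; rewrite /pattern inE.
rewrite add0n -/S -(cardsID S A) (setIidPr SA).
set n := #|[set e in A | _]|; suff -> : n = #|A :\: S| by rewrite addnK.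
apply: eq_card => e; rewrite !inE andbC; congr (_ && _); congr (~~ _).
apply/exists_inP/startsP => -[X XC].
  case/andP=> eX XA; exists X => //; split=> // s f /side_supp/(subsetP XA).
  by rewrite !inE /pattern inE => /andP[fA ef]; split.
case=> eX allX; exists X; rewrite // eX; apply/subsetP => f /suppP[s /allX[ef]].
by rewrite /pattern !inE => fA; apply/andP; split.
Qed.

(** Build E from A by adding the other elements in increasing order. *)
Lemma corank_count A : (rk M' setT - rk M' A)%N =
  #|[set e in ~: A | ~~ blocks M' (pattern setT A) e (e \notin A)]|.
Proof.
have dAC : [disjoint A & ~: A] by rewrite disjoints_subset setCK.
have := rk_count M' (@le_total _ E) le_trans le_anti dAC; rewrite setUCr => ->.
rewrite addKn; apply: eq_card => e; rewrite !inE.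
case: (boolP (e \in A)) => //= eA; congr (~~ _).
apply/exists_inP/blocksP => -[X XC].
  case/andP=> eX XA; have [Y YC [YX eY]] := circuit_orient true XC eX.
  exists Y => //; split=> // s f /side_supp; rewrite YX => /(subsetP XA).
  by rewrite /pattern !inE => /orP[-> // | /andP[_]];
    rewrite leNgt => /negbTE->.
case=> eX allX; exists X; rewrite // (side_supp eX);
  apply/subsetP => f /suppP[s fX].
rewrite !inE; case: (boolP (f \in A)) => //= fA; rewrite leNgt; apply/negP.
by move/(allX _ _ fX); rewrite /pattern inE (negPf fA).
Qed.

Lemma hybrid_setT : hybrid setT = \sum_(A : {set E})
  (x + u - 1) ^+ (rk M' setT - rk M' A) * (y + v - 1) ^+ (#|A| - rk M A).
Proof.
apply: eq_bigr => A _; rewrite nullity_count corank_count.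
rewrite -!prodr_const [X in _ = X * _]big_mkcond [X in _ = _ * X]big_mkcond
  -big_split.
apply: eq_bigr => e _ /=.
by rewrite /weight !inE; case: (e \in A); case: blocks; case: starts.
Qed.

End Weights.

Theorem theorem3p1 (d : Order.disp_t) (E : finOrderType d)
    (M M' : orientedMatroid E) (hMM' : perspective M M') :
  let x : {mpoly int[4]} := 'X_(@Ordinal 4 0 isT) in
  let u : {mpoly int[4]} := 'X_(@Ordinal 4 1 isT) in
  let y : {mpoly int[4]} := 'X_(@Ordinal 4 2 isT) in
  let v : {mpoly int[4]} := 'X_(@Ordinal 4 3 isT) in
  tutte M M' \mPo [tuple x + u; y + v; 1] =
  \sum_(A : {set E})
     x ^+ theta_dual M' A * u ^+ theta_bar_dual M' A *
     y ^+ theta M A * v ^+ theta_bar M A.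
Proof.
move=> x u y v; rewrite /tutte rmorph_sum /=.
under [RHS]eq_bigr => A _ do rewrite -mulrA.
rewrite -hybrid_set0 hybrid_constant // hybrid_setT; apply: eq_bigr => A _.
rewrite !rmorphM !rmorphXn !rmorphB !rmorph1 /= !comp_mpolyXU.
by rewrite /= expr1n mulr1.
Qed.
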